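(* Let $S=K[x_1,\ldots,x_r]$ be a polynomial ring over a field $K$ and let $I\subseteq S$ be a two-dimensional squarefree monomial ideal, i.e. a squarefree monomial ideal such that $S/I$ has Krull dimension $2$ (the ideal $I$ may contain variables). Then, for all $n\geq 1$, $$\text{g-reg}(S/I^n)=\mathrm{reg}(S/I^{(n)}).$$
   Context: $S$ is standard graded with maximal homogeneous ideal $\mathfrak m=(x_1,\ldots,x_r)$. For a finitely generated graded $S$-module $M$, $a_i(M):=\max\{t: H^i_{\mathfrak m}(M)_t\neq 0\}$, where $H^i_{\mathfrak m}$ is local cohomology and $\max\emptyset=-\infty$. The regularity is $\mathrm{reg}(M):=\max\{a_i(M)+i: 0\leq i\leq\dim M\}$ and the geometric regularity is $\text{g-reg}(M):=\max\{a_i(M)+i: i>0\}$. $I^{(n)}$ denotes the $n$-th symbolic power of $I$; for a squarefree monomial ideal $I$ it is $\bigcap_{P}P^n$, with $P$ ranging over the minimal primes of $I$. *)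

(* Defs.v *)
From mathcomp Require Import all_boot all_order all_algebra.
From mathcomp Require Import boolp classical_sets.
From mathcomp Require Import ring_quotient mpoly.
(* Without its notations, because that of the extended line is incompatible
   with those of mpoly.  In [extended int], [EFin t] is the integer t and
   [ENInf int] is -oo. *)
From mathcomp Require Import -(notations) constructive_ereal.

Set Implicit Arguments.
Unset Strict Implicit.
Unset Printing Implicit Defensive.

Import Order.TTheory GRing.Theory Num.Theory.

Local Open Scope classical_set_scope.
Local Open Scope ring_scope.

Section Ideals.
Variables (K : fieldType) (r : nat).
Local Notation S := {mpoly K[r]}.
Implicit Types (G A B I J P : set S).

Definition ideal_gen G : set S :=
  [set f | exists2 s : seq (S * S),
     (forall p, p \in s -> G p.2) & f = \sum_(p <- s) p.1 * p.2].

Definition ideal_mul A B : set S := ideal_gen [set f * g | f in A & g in B].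

Fixpoint ideal_pow I (n : nat) : set S :=
  if n is n'.+1 then ideal_mul I (ideal_pow I n') else setT.

Definition squarefree_monomial_ideal I : Prop :=
  exists2 G : set S,
    (forall g, G g -> exists2 m : 'X_{1..r}, (forall i, (m i <= 1)%N) & g = 'X_[m])
    & I = ideal_gen G.

(* [idealr_closed] includes that 1 is not in the ideal. *)
Definition prime_ideal P : Prop :=
  idealr_closed (mem P) /\ prime_idealr_closed (mem P).

Definition minimal_prime I P : Prop :=
  [/\ prime_ideal P, I `<=` P
    & forall Q, prime_ideal Q -> I `<=` Q -> Q `<=` P -> Q = P].

(* The symbolic power of a squarefree monomial ideal; for other ideals this
   need not be the usual symbolic power. *)
Definition symbolic_pow I (n : nat) : set S :=
  \bigcap_(P in minimal_prime I) ideal_pow P n.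

(* A chain P_0 < ... < P_d of primes of S/J, seen as primes of S containing J. *)
Definition prime_chain J (d : nat) : Prop :=
  exists P : nat -> set S,
    (forall i, (i <= d)%N -> prime_ideal (P i) /\ J `<=` P i) /\
    (forall i, (i < d)%N -> P i `<` P i.+1).

(* The Krull dimension of S/J. *)
Definition krull_dim J : extended int :=
  supremum (ENInf int) [set EFin d%:Z | d in prime_chain J].

End Ideals.

(* Local cohomology of S/J, for a homogeneous ideal J, is the cohomology of the
   Cech complex on the variables.  Its component of cohomological degree i is
   the sum over the i-subsets F of the variables of the localizations of S/J
   at x_F.  Elements of S/J are given by representatives in S, and a cochain
   by a common exponent k and numerators f F, standing for the family of the
   fractions f F / x_F ^+ k. *)
Section LocalCohomology.
Variables (K : fieldType) (r : nat).
Local Notation S := {mpoly K[r]}.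
Implicit Types (J : set S) (F : {set 'I_r}) (i k l : nat) (t : int).

Definition var_prod F : S := \prod_(j in F) 'X_j.

(* a / x_F ^+ k = b / x_F ^+ l in the localization of S/J at x_F. *)
Definition loc_eq J F (a : S) k (b : S) l : Prop :=
  exists p, J (var_prod F ^+ p * (var_prod F ^+ l * a - var_prod F ^+ k * b)).

Definition homog_of_deg t (f : S) : Prop :=
  match t with Posz d => f \is d.-homog | Negz _ => f = 0 end.

(* Every fraction f F / x_F ^+ k is homogeneous of degree t. *)
Definition cech_homog t k (f : {set 'I_r} -> S) : Prop :=
  forall F, homog_of_deg (t + (k * #|F|)%:Z) (f F).

(* The numerators, for the same exponent k, of the Cech differential: the image
   of a / x_(F :\ j) ^+ k in the localization at x_F is
   x_j ^+ k * a / x_F ^+ k. *)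
Definition cech_diff k (f : {set 'I_r} -> S) F : S :=
  \sum_(j in F) (-1) ^+ #|[set h in F | (h < j)%N]| * ('X_j ^+ k * f (F :\ j)).

(* H^i(S/J)_t <> 0: some cocycle of degree t is not a coboundary.  Only the
   numerators at sets of cardinality i (for f) and i - 1 (for g) matter. *)
Definition local_coh_neq0 J i t : Prop :=
  exists k (f : {set 'I_r} -> S),
    [/\ cech_homog t k f,
        forall F, #|F| = i.+1 -> loc_eq J F (cech_diff k f F) k 0 0
      & ~ exists l (g : {set 'I_r} -> S),
            cech_homog t l g /\
            forall F, #|F| = i -> loc_eq J F (f F) k (cech_diff l g F) l].

(* The maxima of the definitions are taken as suprema in the extended integers,
   the supremum of the empty set being -oo. *)
Definition a_inv J i : extended int :=
  supremum (ENInf int) [set EFin t | t in local_coh_neq0 J i].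

(* reg (S/J) and g-reg (S/J). *)
Definition reg J : extended int :=
  supremum (ENInf int)
    [set adde (a_inv J i) (EFin i%:Z)
      | i in [set i | (EFin i%:Z <= krull_dim J)%O]].

Definition g_reg J : extended int :=
  supremum (ENInf int)
    [set adde (a_inv J i) (EFin i%:Z) | i in [set i | (0 < i)%N]].

End LocalCohomology.

(* Main.v *)
Require Import Defs.
From mathcomp Require Import all_boot all_order all_algebra.
From mathcomp Require Import zify ring.
From mathcomp Require Import boolp classical_sets.
From mathcomp Require Import ring_quotient mpoly.
From mathcomp Require Import -(notations) constructive_ereal.

(** Write D for the Stanley-Reisner complex of I. As the dimension is two, the
    faces of D have at most two elements, so that D is a graph, possibly with
    isolated vertices, and the minimal primes of I are generated by the
    variables outside of the facets of D.

    For a monomial ideal J the Cech complex is graded by integral vectors a.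
    Its part of degree a lives on the sets F which contain the negative support
    of a and for which the monomial of exponent a is not in the localization of
    J at x_F; these sets form the degree complex of J at a.  This is Takayama's
    way of computing local cohomology, and [local_coh_neq0P] carries it out.
    The degree complexes of I^n and I^(n) are the same on all sets F with at
    least two elements ([in_loc_sym_pow]), and that of I^(n) is contained in
    that of I^n.  This gives H^2 at once, and shows that H^1 of S/I^(n) is
    nonzero only in degrees where H^1 of S/I^n is.  Both modules have no
    cohomology above degree two, and H^0 of S/I^(n) is zero because the maximal
    ideal is not associated to a symbolic power.  Hence g-reg (S/I^n) is at
    least reg (S/I^(n)).

    For the converse, let H^1 of S/I^n be nonzero in degree a.  If H^1 of
    S/I^(n) is zero there, then some vertex i, called special below, belongs to
    the degree complex of I^n only.  At such a vertex the localized ideals are the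
    symbolic and the ordinary power of a sum of variables and of the edge ideal
    of a complete graph on the neighbours of i; a greedy pairing argument
    ([mon_pow_vertex]) turns their difference into sharp inequalities
    ([specialP]) between n and the exponents at the neighbours and at the other
    vertices.  The vertex i is isolated in the degree complex of I^n, so that
    nonzero H^1 needs either a negative exponent at i or a second vertex in that
    complex.  In each case the inequalities bound the total degree of a by
    2n - 2, by 2n - 1 if D has a cycle of length four, or by 3n - 2 if D has a
    triangle.  On the other hand the existence of two neighbours of i, of such a
    cycle or of a triangle makes H^2 of S/I^(n) nonzero in degree 2n - 3,
    2n - 2 or 3n - 3 ([coh2_wedge], [coh2_square], [coh2_triangle]).  So the
    contribution of a to g-reg (S/I^n) does not exceed reg (S/I^(n)). *)

Set Implicit Arguments.
Unset Strict Implicit.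
Unset Printing Implicit Defensive.

Import Order.TTheory GRing.Theory Num.Theory.

Local Open Scope classical_set_scope.
Local Open Scope ring_scope.

(** * Suprema in the extended integers *)

Lemma int_bounded_max (A : set int) (z u : int) :
  A z -> (forall x, A x -> x <= u) ->
  exists2 m, A m & forall x, A x -> x <= m.
Proof.
move=> Az Au; have [N uN] : exists N : nat, u <= z + N%:Z.
  by exists `|u - z|%N; lia.
have {Au uN} : forall x, A x -> x <= z + N%:Z.
  by move=> x /Au /le_trans; apply.
elim: N z Az => [|N IH] z Az ub; first by exists z => // x /ub; lia.
have [Aw|nA] := pselect (exists2 w, A w & z < w).
  case: Aw => w Aw zw; apply: (IH w Aw) => x /ub; lia.
exists z => // x Ax; rewrite leNgt; apply/negP => zx.
by apply: nA; exists x.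
Qed.

(** The operator returns its default value on sets without a least upper bound,
    so that the maxima in the definitions mean what they should only because
    the extended integers are complete: a nonempty bounded set of integers even
    has a maximum. *)
Lemma supremum_isLub (X : set (extended int)) :
  supremums X (supremum (ENInf int) X).
Proof.
rewrite /supremum; case: ifPn => [/eqP ->|/set0P[x0 Xx0]].
  by split=> // y _; rewrite leNye.
suff [s sX] : exists s, supremums X s by case: xgetP => // /(_ s).
have [Xy|nXy] := pselect (exists x, X x /\ x = EPInf int).
  case: Xy => x [Xx x_eq]; rewrite x_eq in Xx; exists (EPInf int).
  by split=> [z _|z]; [rewrite leey | apply].
pose A : set int := [set t | X (EFin t)].
have [[u Au]|nu] := pselect (exists u, forall t, A t -> t <= u); last first.
  exists (EPInf int); split=> [x _|y uy]; first by rewrite leey.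
  case: y uy => [v| |] uy //; exfalso; apply: nu.
    by exists v => t /uy; rewrite lee_fin.
  by exists 0 => t /uy; rewrite leeNy_eq.
have [[z Az]|nA] := pselect (exists z, A z).
  have [m Am mA] := int_bounded_max Az Au; exists (EFin m); split.
    move=> [t| |] Xt; rewrite ?leNye ?lee_fin //; first exact: mA.
    by exfalso; apply: nXy; exists (EPInf int).
  by move=> y; apply.
exists (ENInf int); split=> [[t| |] Xt|y _]; rewrite ?leNye //.
  by exfalso; apply: nA; exists t.
by exfalso; apply: nXy; exists (EPInf int).
Qed.

Lemma supremum_le (X : set (extended int)) (M : extended int) :
  (supremum (ENInf int) X <= M)%O <-> ubound X M.
Proof.
have [ub lub] := supremum_isLub X; split; last exact: lub.
by move=> le x /ub /le_trans; apply.
Qed.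

Lemma supremum_eq (X Y : set (extended int)) :
  (forall M, ubound X M <-> ubound Y M) ->
  supremum (ENInf int) X = supremum (ENInf int) Y.
Proof.
move=> XY; apply/le_anti/andP; split; apply/supremum_le/XY.
  by have [] := supremum_isLub Y.
by have [] := supremum_isLub X.
Qed.

(** The shift by z commutes with the supremum also when it is -oo, where the sum
    is -oo again. *)
Lemma adde_supremum_le (A : set int) (z : int) (M : extended int) :
  (adde (supremum (ENInf int) [set EFin t | t in A]) (EFin z) <= M)%O <->
  (forall t, A t -> (EFin (t + z) <= M)%O).
Proof.
rewrite -leeBrDr //; split=> [/supremum_le ub t At|H].
  have := ub (EFin t); rewrite leeBrDr // -EFinD; apply.
  by exists t.
apply/supremum_le => _ [t At <-]; rewrite leeBrDr // -EFinD; exact: H.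
Qed.

(** * Monomial ideals and integral multidegrees *)

Section Multidegrees.
Variables (K : fieldType) (r : nat).
Local Notation S := {mpoly K[r]}.
Local Notation deg := {ffun 'I_r -> int}.
Implicit Types (f g : S) (a b : deg) (F G : {set 'I_r}) (k l p : nat).
Implicit Types (A : 'X_{1..r} -> Prop).

Definition upclosed A := forall m m', A m -> (m <= m')%MM -> A m'.

Definition mon_ideal A : set S := [set f | forall m, m \in msupp f -> A m].

Definition zmon a : 'X_{1..r} := [multinom `|a j|%N | j < r].

(** Allowing integral exponents makes division by a monomial total: the
    coefficient at an exponent with a negative entry is zero. *)
Definition zcoef f a : K := if [forall j, 0 <= a j] then f@_(zmon a) else 0.

Definition shift a F k : deg := [ffun j => a j + (k * (j \in F))%:Z].

Definition zmem A a := (forall j, 0 <= a j) /\ A (zmon a).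

(** The monomial of exponent a, possibly with negative entries on F, lies in the
    localization at x_F of the monomial ideal given by A. *)
Definition in_loc A F a := exists p, zmem A (shift a F p).

Definition of_mon (m : 'X_{1..r}) : deg := [ffun j => (m j)%:Z].

Lemma degP a b : (forall j, a j = b j) -> a = b.
Proof. by move=> ab; apply/ffunP. Qed.

Lemma degBE a b j : (a - b) j = a j - b j :> int.
Proof. by rewrite !ffunE. Qed.

Lemma zmon_of_mon m : zmon (of_mon m) = m.
Proof. by apply/mnmP => j; rewrite mnmE ffunE. Qed.

Lemma zcoef_of_mon f m : zcoef f (of_mon m) = f@_m.
Proof.
rewrite /zcoef zmon_of_mon ifT //; apply/forallP => j; by rewrite ffunE.
Qed.

Lemma of_zmon a : (forall j, 0 <= a j) -> of_mon (zmon a) = a.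
Proof.
by move=> a0; apply: degP => j; rewrite ffunE mnmE gez0_abs.
Qed.

Lemma zcoef_neq0 f a :
  zcoef f a != 0 -> (forall j, 0 <= a j) /\ zmon a \in msupp f.
Proof.
rewrite /zcoef; case: ifPn => [/forallP a0 fa|]; last by rewrite eqxx.
by rewrite mcoeff_msupp.
Qed.

Lemma zcoef_lt0 f a j : a j < 0 -> zcoef f a = 0.
Proof.
move=> aj; rewrite /zcoef ifF //; apply/negbTE/forallPn; exists j.
by rewrite -ltNge.
Qed.

Lemma zcoefB f g a : zcoef (f - g) a = zcoef f a - zcoef g a.
Proof. by rewrite /zcoef; case: ifP => _; rewrite ?mcoeffB ?subr0. Qed.

Lemma zcoef0 a : zcoef 0 a = 0.
Proof. by rewrite /zcoef mcoeff0 if_same. Qed.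

Lemma zcoefZ c f a : zcoef (c *: f) a = c * zcoef f a.
Proof. by rewrite /zcoef; case: ifP => _; rewrite ?mcoeffZ ?mulr0. Qed.

Lemma zcoef_sum (T : Type) (s : seq T) (P : pred T) (f : T -> S) a :
  zcoef (\sum_(i <- s | P i) f i) a = \sum_(i <- s | P i) zcoef (f i) a.
Proof.
by rewrite /zcoef; case: ifP => _; [rewrite raddf_sum | rewrite big1].
Qed.

Lemma zcoefX m a : zcoef 'X_[m] a = (a == of_mon m)%:R.
Proof.
rewrite /zcoef; case: ifPn => [/forallP a0|/forallPn[j aj]].
  rewrite mcoeffX; congr (_ (nat_of_bool _)); apply/eqP/eqP => [->|->].
    by rewrite of_zmon.
  by rewrite zmon_of_mon.
case: eqP => // a_eq; case/negP: aj; by rewrite a_eq ffunE.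
Qed.

Lemma zcoefXM m f a : zcoef ('X_[m] * f) a = zcoef f (a - of_mon m).
Proof.
pose b := a - of_mon m; rewrite -/b.
have [/forallP b0|/forallPn[j bj]] := boolP [forall j, 0 <= b j].
  have -> : a = of_mon (m + zmon b)%MM.
    apply: degP => j; rewrite ffunE mnmDE mnmE.
    by rewrite PoszD gez0_abs // degBE ffunE; lia.
  by rewrite zcoef_of_mon mulrC mcoeffMX -zcoef_of_mon of_zmon.
rewrite (@zcoef_lt0 f _ j); last by rewrite ltNge.
apply/eqP/negPn/negP => /zcoef_neq0[a0].
have -> : zmon a \in msupp ('X_[m] * f) = (zmon a \in msupp (f * 'X_[m])).
  by rewrite mulrC.
rewrite (perm_mem (msuppMX _ _)) => /mapP[m' _ m_eq].
case/negP: bj; rewrite degBE ffunE; move: (congr1 (fun m : 'X_{1..r} => m j) m_eq).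
by rewrite mnmDE mnmE; move: (a0 j); lia.
Qed.

Lemma var_prodXE F k :
  var_prod K F ^+ k = 'X_[ [multinom (k * (j \in F))%N | j < r] ].
Proof.
rewrite mpolyXE_id /var_prod -prodrXl [RHS](bigID (mem F)) /= [X in _ = _ * X]big1.
  by rewrite mulr1; apply: eq_bigr => j jF; rewrite mnmE jF muln1.
by move=> j /negbTE jF; rewrite mnmE jF muln0.
Qed.

Lemma zcoef_var_prodM F k f a : zcoef (var_prod K F ^+ k * f) (shift a F k) = zcoef f a.
Proof.
rewrite var_prodXE zcoefXM; congr zcoef; apply: degP => j.
by rewrite !ffunE mnmE addrK.
Qed.

Lemma shiftD a F k l : shift (shift a F k) F l = shift a F (k + l).
Proof. by apply: degP => j; rewrite !ffunE; lia. Qed.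

Lemma mon_idealP A f : mon_ideal A f <-> forall a, zcoef f a != 0 -> zmem A a.
Proof.
split=> [Af a /zcoef_neq0[a0 af]|H m mf]; first by split=> //; apply: Af.
have [] := H (of_mon m); first by rewrite zcoef_of_mon -mcoeff_msupp.
by rewrite zmon_of_mon.
Qed.

Lemma zmem_shift A F a k l :
  upclosed A -> zmem A (shift a F k) -> (k <= l)%N -> zmem A (shift a F l).
Proof.
move=> upA [a0 Aa] kl; split=> [j|].
  by move: (a0 j); rewrite !ffunE; case: (j \in F); lia.
apply: upA Aa _; apply/mnm_lepP => j; rewrite !mnmE.
by move: (a0 j); rewrite !ffunE; case: (j \in F); lia.
Qed.

(** A fraction vanishes in the localization as soon as each of its finitely
    many monomials does, because one power of the denominator serves all. *)
Lemma loc_eqP A F f k g l : upclosed A ->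
  loc_eq (mon_ideal A) F f k g l <->
  forall a, ~ in_loc A F a -> zcoef f (shift a F k) = zcoef g (shift a F l).
Proof.
move=> upA; pose h := var_prod K F ^+ l * f - var_prod K F ^+ k * g.
have hE a : zcoef h (shift a F (k + l)) =
    zcoef f (shift a F k) - zcoef g (shift a F l).
  rewrite zcoefB -{1}shiftD zcoef_var_prodM; congr (_ - _).
  by rewrite addnC -shiftD zcoef_var_prodM.
split=> [[p /mon_idealP hA] a na|H].
  apply/eqP; rewrite -subr_eq0 -hE; apply/negPn/negP => h0.
  apply: na; exists (k + l + p)%N; apply: hA.
  by rewrite -shiftD zcoef_var_prodM.
have loc m : m \in msupp h -> in_loc A F (of_mon m).
  rewrite mcoeff_msupp -zcoef_of_mon => mh; apply: contrapT => nm.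
  pose a := of_mon m - shift 0 F (k + l).
  have am : of_mon m = shift a F (k + l).
    by apply: degP => j; rewrite [RHS]ffunE degBE !ffunE; lia.
  move: mh; rewrite am hE H ?subrr ?eqxx // => -[p Ap].
  apply: nm; exists p; rewrite am shiftD.
  by apply: zmem_shift Ap (leq_addl _ _).
have [p hp] : exists p, forall m, m \in msupp h -> zmem A (shift (of_mon m) F p).
  elim: (msupp h) loc => [|m s IH] loc; first by exists 0%N.
  have [|q qP] := IH; first by move=> m' ms; apply: loc; rewrite inE ms orbT.
  have [q' q'P] := loc m (mem_head _ _).
  exists (maxn q q') => m'; rewrite inE => /predU1P[->|ms].
    exact: zmem_shift q'P (leq_maxr _ _).
  exact: zmem_shift (qP _ ms) (leq_maxl _ _).
exists p; apply/mon_idealP => a pa.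
pose b := a - shift 0 F p.
have ab : a = shift b F p.
  by apply: degP => j; rewrite ffunE degBE !ffunE; lia.
move: pa; rewrite ab zcoef_var_prodM => /zcoef_neq0[b0 bh].
by rewrite -(of_zmon b0); apply: hp.
Qed.

(** The negative degrees, where only zero is homogeneous, need no separate
    treatment with integral exponents. *)
Lemma homog_of_degP t f :
  homog_of_deg t f <-> forall a, zcoef f a != 0 -> \sum_j a j = t.
Proof.
have sumE a : (forall j, 0 <= a j) -> \sum_j a j = (mdeg (zmon a))%:Z.
  move=> a0; rewrite mdegE (big_morph Posz PoszD (erefl _)).
  by apply: eq_bigr => j _; rewrite mnmE gez0_abs.
split; last first.
  move=> H; have Hm m : m \in msupp f -> (mdeg m)%:Z = t.
    rewrite mcoeff_msupp -zcoef_of_mon => /H <-.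
    rewrite sumE ?zmon_of_mon // => j; by rewrite ffunE.
  case: t Hm {H} => d Hm.
    by apply/dhomogP => m /Hm [].
  apply/eqP; rewrite -msupp_eq0; case: (msupp f) Hm => // m s /(_ m).
  by rewrite mem_head => /(_ isT).
case: t => d /= H a.
  move/dhomogP: H => H /zcoef_neq0[a0 /H af]; by rewrite sumE // af.
by rewrite H zcoef0 eqxx.
Qed.

Lemma sum_shift a F k : \sum_j shift a F k j = \sum_j a j + (k * #|F|)%:Z.
Proof.
rewrite -sum1_card big_distrr /= (big_morph Posz PoszD (erefl _)) /=.
rewrite [X in _ + X](big_mkcond (mem F)) -big_split /=.
by apply: eq_bigr => j _; rewrite ffunE; case: (j \in F); rewrite ?muln0.
Qed.

Lemma cech_homogP t k (f : {set 'I_r} -> S) :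
  cech_homog t k f <->
  forall F a, zcoef (f F) (shift a F k) != 0 -> \sum_j a j = t.
Proof.
split=> H F.
  move=> a fa; have /homog_of_degP/(_ _ fa) := H F.
  by rewrite sum_shift => /addIr.
apply/homog_of_degP => a fa; have ab : a = shift (a - shift 0 F k) F k.
  by apply: degP => j; rewrite ffunE degBE !ffunE; lia.
by rewrite ab sum_shift (H F) // -ab.
Qed.

Definition sgn_face F j : K := (-1) ^+ #|[set h in F | (h < j)%N]|.

Lemma zcoef_signM n f a : zcoef ((-1) ^+ n * f) a = (-1) ^+ n * zcoef f a.
Proof.
rewrite -(signr_odd S) -(signr_odd K).
by case: odd; rewrite ?expr0 ?expr1 ?mul1r // !mulN1r -sub0r zcoefB zcoef0 sub0r.
Qed.

Lemma zcoef_cech_diff k (f : {set 'I_r} -> S) F a :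
  zcoef (cech_diff k f F) (shift a F k) =
  \sum_(j in F) sgn_face F j * zcoef (f (F :\ j)) (shift a (F :\ j) k).
Proof.
rewrite zcoef_sum; apply: eq_bigr => j jF.
rewrite zcoef_signM mpolyXn zcoefXM; congr (_ * zcoef _ _).
apply: degP => i; rewrite degBE !ffunE mulmnE mnm1E !inE.
case: (eqVneq i j) => [->|ij] /=.
  by rewrite jF; lia.
by rewrite mul0n subr0.
Qed.

End Multidegrees.

(** * The multigraded Cech complex *)

Section Multigraded.
Variables (K : fieldType) (r : nat).
Local Notation S := {mpoly K[r]}.
Local Notation deg := {ffun 'I_r -> int}.
Implicit Types (a : deg) (E F G : {set 'I_r}) (k l i : nat).
Implicit Types (f g : {set 'I_r} -> S) (c b : {set 'I_r} -> K).
Implicit Types (A : 'X_{1..r} -> Prop).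

Definition neg a : {set 'I_r} := [set j | a j < 0].

Definition cech_dlt G c F : K :=
  \sum_(j in F | G \subset F :\ j) sgn_face K F j * c (F :\ j).

(** The multigraded Cech complex in a degree with negative support G, where D
    holds for the sets F at which the localization has a nonzero component.  As
    D is inherited by the smaller sets that contain G, the differential refers
    to D only through its target, and values outside of D are harmless. *)
Definition coh_neq0 G (D : {set 'I_r} -> Prop) i : Prop :=
  exists c,
    (forall F, G \subset F -> #|F| = i.+1 -> D F -> cech_dlt G c F = 0) /\
    ~ exists b, forall F, G \subset F -> #|F| = i -> D F ->
        c F = cech_dlt G b F.

Definition component k f a F : K := zcoef (f F) (shift a F k).

Lemma eq_cech_dlt G c b F :
  (forall E, G \subset E -> c E = b E) -> cech_dlt G c F = cech_dlt G b F.
Proof. by move=> cb; apply: eq_bigr => j /andP[_ /cb ->]. Qed.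

Lemma cech_dlt0 G c F :
  (forall E, G \subset E -> c E = 0) -> cech_dlt G c F = 0.
Proof. by move=> c0; apply: big1 => j /andP[_ /c0 ->]; rewrite mulr0. Qed.

Lemma cech_dlt_out G c F : ~~ (G \subset F) -> cech_dlt G c F = 0.
Proof.
move=> GF; rewrite /cech_dlt big1 // => j /andP[_ GFj]; case/negP: GF.
exact: fintype.subset_trans GFj (subD1set _ _).
Qed.

Lemma component_out k f a F : ~~ (neg a \subset F) -> component k f a F = 0.
Proof.
case/subsetPn => j; rewrite inE => aj jF; apply: (@zcoef_lt0 _ _ _ _ j).
by rewrite ffunE (negbTE jF) muln0 addr0.
Qed.

Lemma zcoef_cech_dlt k f F a :
  zcoef (cech_diff k f F) (shift a F k) =
  cech_dlt (neg a) (component k f a) F.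
Proof.
rewrite zcoef_cech_diff /cech_dlt big_mkcondr; apply: eq_bigr => j jF.
case: ifPn => // nF.
by have := component_out k f nF; rewrite /component => ->; rewrite mulr0.
Qed.

(** The degrees that meet a given cochain are finitely many, because each
    numerator has finite support. *)
Lemma component_support k f :
  exists2 s : seq deg, uniq s &
    forall a, a \in s <-> exists F, component k f a F != 0.
Proof.
exists (undup [seq of_mon m - shift 0 F k | F <- enum {set 'I_r},
                                            m <- msupp (f F)]).
  exact: undup_uniq.
move=> a; rewrite mem_undup; split.
  case/allpairsPdep => F [m [_ mf ->]]; exists F.
  rewrite /component.
  have -> : shift (of_mon m - shift 0 F k) F k = of_mon m.
    by apply: degP => j; rewrite ffunE degBE !ffunE; lia.
  by rewrite zcoef_of_mon -mcoeff_msupp.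
case=> F /zcoef_neq0[a0 af]; apply/allpairsPdep.
exists F, (zmon (shift a F k)); split=> //; first by rewrite mem_enum.
by rewrite of_zmon //; apply: degP => j; rewrite degBE !ffunE; lia.
Qed.

(** A cochain with prescribed multigraded components b a, for a in s. *)
Definition assemble (s : seq deg) k (b : deg -> {set 'I_r} -> K) F : S :=
  \sum_(a <- s | neg a \subset F) b a F *: 'X_[zmon (shift a F k)].

Lemma component_assemble (s : seq deg) k (b : deg -> {set 'I_r} -> K) a F :
  uniq s -> (forall a', a' \in s -> forall j, 0 <= a' j + k%:Z) ->
  neg a \subset F ->
  component k (assemble s k b) a F = if a \in s then b a F else 0.
Proof.
move=> us sk aF; rewrite /component zcoef_sum.
have E a' : a' \in s -> neg a' \subset F ->
    zcoef (b a' F *: 'X_[zmon (shift a' F k)]) (shift a F k) =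
    if a == a' then b a' F else 0.
  move=> a's a'F; rewrite zcoefZ zcoefX of_zmon; last first.
    move=> j; rewrite ffunE; case: (boolP (j \in F)) => jF.
      by rewrite muln1 sk.
    rewrite muln0 addr0 leNgt; apply: contra jF => aj.
    by apply: (fintype.subsetP a'F); rewrite inE.
  have -> : (shift a F k == shift a' F k) = (a == a').
    apply/eqP/eqP => [e|-> //]; apply: degP => j.
    by move: (congr1 (fun x : deg => x j) e); rewrite !ffunE => /addIr.
  by case: eqP; rewrite ?mulr1 ?mulr0.
rewrite big_seq_cond (eq_bigr (fun a' => if a == a' then b a' F else 0));
  last by move=> a' /andP[]; apply: E.
rewrite -big_seq_cond -big_mkcondr /=.
case: ifPn => [sa|sa]; last first.
  rewrite big_seq_cond big1 // => a' /and3P[a's _ /eqP aa'].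
  by rewrite aa' a's in sa.
rewrite big_mkcond (bigD1_seq a) //= aF eqxx /= big1 ?addr0 // => a'.
by rewrite eq_sym => /negbTE ->; rewrite andbF.
Qed.

(** The Cech complex of a monomial ideal splits into its multigraded components.
    Only finitely many of them meet a given cochain, so that primitives chosen
    degree by degree add up to a primitive with a common denominator. *)
Lemma local_coh_neq0P A i t : upclosed A ->
  local_coh_neq0 (@mon_ideal K r A) i t <->
  exists a, \sum_j a j = t /\ coh_neq0 (neg a) (fun F => ~ in_loc A F a) i.
Proof.
move=> upA; split.
  case=> k [f [/cech_homogP fh fc nf]]; apply: contrapT => nc.
  have [s us sP] := component_support k f.
  have st a : a \in s -> \sum_j a j = t by move/sP => [F /fh].
  have sk a : a \in s -> forall j, 0 <= a j + k%:Z.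
    move/sP => [F /zcoef_neq0[a0 _] j]; move: (a0 j); rewrite ffunE.
    by case: (j \in F); lia.
  have /choice[b bP] : forall a, exists b, a \in s ->
      forall F, neg a \subset F -> #|F| = i -> ~ in_loc A F a ->
        component k f a F = cech_dlt (neg a) b F.
    move=> a; case: (boolP (a \in s)) => [sa|_]; last by exists (fun=> 0).
    apply: contrapT => nb; apply: nc; exists a; split; first exact: st.
    exists (component k f a); split=> [F aF Fi na|[b bP]]; last first.
      by apply: nb; exists b.
    have /(loc_eqP _ _ _ _ _ upA)/(_ a na) := fc F Fi.
    by rewrite zcoef_cech_dlt zcoef0.
  apply: nf; exists k, (assemble s k b); split.
    apply/cech_homogP => F a ga; apply: st.
    have aF : neg a \subset F.
      by apply: contraNT ga => /(component_out k (assemble s k b)) /eqP.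
    move: ga; rewrite -/(component k (assemble s k b) a F).
    by rewrite component_assemble //; case: ifP; rewrite ?eqxx.
  move=> F Fi; apply/loc_eqP => // a na.
  rewrite zcoef_cech_dlt -/(component k f a F).
  case: (boolP (neg a \subset F)) => aF; last first.
    by rewrite component_out // cech_dlt_out.
  case: (boolP (a \in s)) => sa.
    rewrite (bP a sa) //; apply: eq_cech_dlt => E aE.
    by rewrite component_assemble // sa.
  rewrite cech_dlt0 => [|E aE]; last first.
    by rewrite component_assemble // (negbTE sa).
  by apply/eqP; apply: contraNT sa => fa; apply/sP; exists F.
case=> a [at_ [c [cc nc]]].
(* The exponent k must make every a j + k nonnegative. *)
pose k := (\sum_j `|a j|)%N; pose f := assemble [:: a] k (fun=> c).
have ak j : 0 <= a j + k%:Z.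
  have : (`|a j| <= k)%N by rewrite /k (bigD1 j) //= leq_addr.
  by lia.
have fE a' F : neg a' \subset F ->
    component k f a' F = if a' == a then c F else 0.
  move=> aF; rewrite component_assemble //; first by rewrite inE; case: eqP => // ->.
  by move=> a2; rewrite inE => /eqP ->.
exists k, f; split.
- apply/cech_homogP => F a' fa.
  have aF : neg a' \subset F.
    by apply: contraNT fa => /(component_out k f) /eqP.
  move: fa; rewrite -/(component k f a' F) fE //.
  by case: (eqVneq a' a) => [-> //|]; rewrite eqxx.
- move=> F Fi; apply/loc_eqP => // a' na; rewrite zcoef_cech_dlt zcoef0.
  case: (boolP (neg a' \subset F)) => aF; last by rewrite cech_dlt_out.
  case: (eqVneq a' a) => [aa|aa].
    rewrite -(cc F _ Fi); rewrite -?aa //; apply: eq_cech_dlt => E aE.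
    by rewrite fE // aa eqxx.
  by apply: cech_dlt0 => E aE; rewrite fE // (negbTE aa).
case=> l [g [_ gP]]; apply: nc; exists (component l g a) => F aF Fi na.
have /(loc_eqP _ _ _ _ _ upA)/(_ a na) := gP F Fi.
by rewrite zcoef_cech_dlt -/(component k f a F) fE // eqxx.
Qed.

End Multigraded.

(** * Powers of monomial ideals and primes generated by variables *)

Section MonomialIdeals.
Variables (K : fieldType) (r : nat).
Local Notation S := {mpoly K[r]}.
Local Notation mon := (@mon_ideal K r).
Implicit Types (f g : S) (m : 'X_{1..r}) (E F : {set 'I_r}) (n : nat).
Implicit Types (A B : 'X_{1..r} -> Prop) (I P Q : set S).
Implicit Types (D : {set 'I_r} -> Prop).

Definition ideal_like Q := Q 0 /\ forall f g h, Q g -> Q h -> Q (f * g + h).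

Definition mvars m : {set 'I_r} := [set j | m j != 0%N].

Lemma ideal_like_sum Q (T : eqType) (s : seq T) (f : T -> S) :
  ideal_like Q -> (forall x, x \in s -> Q (f x)) -> Q (\sum_(x <- s) f x).
Proof.
move=> [Q0 QD]; elim: s => [|x s IH] Qs; first by rewrite big_nil.
rewrite big_cons -[f x]mul1r; apply: QD; first by apply: Qs; rewrite mem_head.
by apply: IH => y ys; apply: Qs; rewrite inE ys orbT.
Qed.

Lemma ideal_like_mul Q f g : ideal_like Q -> Q g -> Q (f * g).
Proof. by move=> [Q0 QD] Qg; rewrite -[f * g]addr0; apply: QD. Qed.

Lemma mon_ideal_sub A Q :
  ideal_like Q -> (forall m, A m -> Q 'X_[m]) -> mon A `<=` Q.
Proof.
move=> Qid AQ f Af; rewrite [f]mpolyE; apply: ideal_like_sum => // m mf.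
by rewrite -mul_mpolyC; apply: ideal_like_mul => //; apply/AQ/Af.
Qed.

Lemma mon_idealX A m : mon A 'X_[m] <-> A m.
Proof.
by split=> [|Am m']; [apply; rewrite msuppX mem_head | rewrite msuppX inE => /eqP ->].
Qed.

Lemma mon_ideal_like A : upclosed A -> ideal_like (mon A).
Proof.
move=> upA; split=> [m|f g h Ag Ah m]; first by rewrite msupp0.
move/msuppD_le; rewrite mem_cat => /orP[|/Ah //].
move/msuppM_le => /allpairsP[[m1 m2] [_ /Ag Am2 ->]].
by apply: upA Am2 _; apply: lem_addl.
Qed.

Lemma ideal_gen_like (G : set S) : ideal_like (ideal_gen G).
Proof.
split=> [|f g h [s sG ->] [s' sG' ->]]; first by exists [::]; rewrite ?big_nil.
exists ([seq (f * p.1, p.2) | p <- s] ++ s').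
  by move=> p; rewrite mem_cat => /orP[/mapP[q /sG Gq ->]|/sG'].
rewrite big_cat big_map /= big_distrr /=; congr (_ + _).
by apply: eq_bigr => p _; rewrite mulrA.
Qed.

Lemma ideal_gen_base (G : set S) g : G g -> ideal_gen G g.
Proof.
move=> Gg; exists [:: (1, g)]; last by rewrite big_seq1 mul1r.
by move=> p; rewrite inE => /eqP ->.
Qed.

Lemma ideal_gen_sub (G Q : set S) :
  ideal_like Q -> G `<=` Q -> ideal_gen G `<=` Q.
Proof.
move=> Qid GQ f [s sG ->]; apply: ideal_like_sum => // p /sG /GQ.
exact: ideal_like_mul.
Qed.

Lemma mon_ideal_mono A B : (forall m, A m -> B m) -> mon A `<=` mon B.
Proof. by move=> AB f Af m /Af /AB. Qed.

Lemma eq_mon_ideal A B : (forall m, A m <-> B m) -> mon A = mon B.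
Proof.
by move=> AB; apply/seteqP; split; apply: mon_ideal_mono => m /AB.
Qed.

Definition mon_sum A B m := exists m1 m2, [/\ A m1, B m2 & m = (m1 + m2)%MM].

Fixpoint mon_pow A n : 'X_{1..r} -> Prop :=
  if n is n'.+1 then mon_sum A (mon_pow A n') else fun=> True.

Lemma upclosed_sum A B : upclosed A -> upclosed (mon_sum A B).
Proof.
move=> upA _ m [m1 [m2 [Am1 Bm2 ->]]] le.
exists (m1 + (m - (m1 + m2)))%MM, m2; split=> //.
  by apply: upA Am1 _; apply: lem_addr.
by rewrite -addmA [X in (m1 + X)%MM]addmC addmA addmC submK.
Qed.

Lemma upclosed_pow A n : upclosed A -> upclosed (mon_pow A n).
Proof. by move=> upA; case: n => [//|n]; apply: upclosed_sum. Qed.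

Lemma ideal_mul_mon A B : upclosed A -> upclosed B ->
  ideal_mul (mon A) (mon B) = mon (mon_sum A B).
Proof.
move=> upA upB; apply/seteqP; split.
  apply: ideal_gen_sub; first exact/mon_ideal_like/upclosed_sum.
  move=> _ [f Af [g Bg <-]] m /msuppM_le /allpairsP[[m1 m2] /= [/Af Am1 /Bg Bm2 ->]].
  by exists m1, m2.
apply: mon_ideal_sub; first exact: ideal_gen_like.
move=> _ [m1 [m2 [Am1 Bm2 ->]]]; apply: ideal_gen_base.
exists 'X_[m1]; first exact/mon_idealX.
by exists 'X_[m2]; [apply/mon_idealX | rewrite mpolyXD].
Qed.

Lemma ideal_pow_mon A n : upclosed A ->
  ideal_pow (mon A) n = mon (mon_pow A n).
Proof.
move=> upA; elim: n => [|n IH] /=; first by apply/seteqP; split.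
by rewrite IH ideal_mul_mon //; apply: upclosed_pow.
Qed.

(** The monomials of the Stanley-Reisner ideal of D. *)
Definition nonface_mon D m : Prop := ~ D (mvars m).

Definition downclosed D := forall E F, D F -> E \subset F -> D E.

Lemma mvarsS m m' : (m <= m')%MM -> mvars m \subset mvars m'.
Proof.
move/mnm_lepP => le; apply/fintype.subsetP => j; rewrite !inE.
by move: (le j); lia.
Qed.

Lemma mvarsD m m' : mvars (m + m')%MM = mvars m :|: mvars m'.
Proof. by apply/setP => j; rewrite !inE mnmDE addn_eq0 negb_and. Qed.

Lemma upclosed_nonface D : downclosed D -> upclosed (nonface_mon D).
Proof.
move=> dD m m' nm /mvarsS le /dD Dm; apply: nm; exact: Dm.
Qed.

(** A squarefree generator divides a monomial as soon as its support is contained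
    in that of the monomial, so membership depends on the support alone. *)
Lemma squarefree_nonface I : squarefree_monomial_ideal I ->
  exists2 D, downclosed D & I = mon (nonface_mon D).
Proof.
case=> G sqG ->.
pose D F := forall m, G 'X_[m] -> ~~ (mvars m \subset F).
have dD : downclosed D.
  move=> E F DF EF m Gm; apply: contra (DF m Gm) => mE.
  exact: fintype.subset_trans mE EF.
exists D => //; apply/seteqP; split.
  apply: ideal_gen_sub; first exact/mon_ideal_like/upclosed_nonface.
  move=> g Gg; have [m _ gE] := sqG _ Gg; rewrite gE in Gg *.
  by apply/mon_idealX => /(_ m Gg); rewrite subxx.
apply: mon_ideal_sub; first exact: ideal_gen_like.
move=> m /existsNP[m' /not_implyP[Gm' /negP/negPn m'm]].
have [m2 m2sq /(congr1 (fun p : S => msupp p))] := sqG _ Gm'.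
rewrite !msuppX => -[mE].
have le : (m' <= m)%MM.
  apply/mnm_lepP => j; move/fintype.subsetP: m'm => /(_ j).
  by rewrite !inE mE; move: (m2sq j); lia.
rewrite -(submK le) mpolyXD; apply: ideal_like_mul; first exact: ideal_gen_like.
exact: ideal_gen_base.
Qed.

Definition var_prime F : set S := mon (fun m => ~~ (mvars m \subset F)).

Lemma upclosed_var F : upclosed (fun m => ~~ (mvars m \subset F)).
Proof.
by move=> m m' + /mvarsS le; apply: contra; apply: fintype.subset_trans.
Qed.

Lemma mvars0 : mvars 0%MM = finset.set0.
Proof. by apply/setP => j; rewrite !inE mnm0E eqxx. Qed.

Lemma mvars1 j : mvars U_(j)%MM = [set j]%SET.
Proof. by apply/setP => i; rewrite !inE mnm1E (eq_sym i); case: (j == i). Qed.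

(** Modulo the ideal, a product of polynomials is the product of their parts
    in the remaining variables, and these form a domain. *)
Lemma var_prime_prime F : prime_ideal (var_prime F).
Proof.
have Pid : ideal_like (var_prime F) := mon_ideal_like (@upclosed_var F).
have [P0 PD] := Pid; split.
  split; first by rewrite inE.
    apply/negP; rewrite inE -mpolyX0 => /mon_idealX.
    by rewrite mvars0 finset.sub0set.
  by move=> f g h; rewrite !inE; apply: PD.
pose rest (f : S) : S := \sum_(m <- msupp f | mvars m \subset F) f@_m *: 'X_[m].
have restE f : exists2 p, var_prime F p & f = p + rest f.
  exists (\sum_(m <- msupp f | ~~ (mvars m \subset F)) f@_m *: 'X_[m]).
    rewrite -big_filter; apply: ideal_like_sum => // m.
    rewrite mem_filter => /andP[mF _]; rewrite -mul_mpolyC.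
    by apply: (ideal_like_mul _ Pid); apply/mon_idealX.
  by rewrite [LHS]mpolyE (bigID (fun m => mvars m \subset F)) addrC.
have rest_supp f m : m \in msupp (rest f) -> mvars m \subset F.
  move=> /msupp_sum_le /flattenP[s /mapP[m']].
  by rewrite mem_filter => /andP[m'F _] -> /msuppZ_le; rewrite msuppX inE => /eqP ->.
have PB f g : var_prime F f -> var_prime F g -> var_prime F (g - f).
  by move=> Pf Pg; rewrite addrC -mulN1r; apply: PD.
move=> f g; rewrite !inE; have [p Pp fE] := restE f; have [q Pq gE] := restE g.
move=> Pfg; have : var_prime F (rest f * rest g).
  have -> : rest f * rest g = f * g - (rest g * p + f * q).
    have -> : rest f = f - p by apply/eqP; rewrite eq_sym subr_eq addrC -fE.
    have -> : rest g = g - q by apply/eqP; rewrite eq_sym subr_eq addrC -gE.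
    by ring.
  by apply: PB => //; apply: PD => //; apply: (ideal_like_mul _ Pid).
move=> Prr; have /eqP : rest f * rest g = 0.
  apply: msuppnil0; case E: (msupp _) => [//|m s].
  have mr : m \in msupp (rest f * rest g) by rewrite E mem_head.
  have /negP[] := Prr m mr.
  case/msuppM_le/allpairsP: mr => -[m1 m2] /= [/rest_supp m1F /rest_supp m2F ->].
  by rewrite mvarsD finset.subUset m1F.
rewrite mulf_eq0 => /orP[] /eqP r0; apply/orP; [left|right]; rewrite inE.
  by rewrite fE r0 addr0.
by rewrite gE r0 addr0.
Qed.

End MonomialIdeals.

Arguments var_prime K {r} F _.

(** * Faces, minimal primes and symbolic powers *)

Section StanleyReisner.
Variables (K : fieldType) (r : nat) (D : {set 'I_r} -> Prop).
Local Notation S := {mpoly K[r]}.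
Local Notation mon := (@mon_ideal K r).
Hypothesis dD : downclosed D.
Implicit Types (f g : S) (m : 'X_{1..r}) (E F : {set 'I_r}) (n : nat).
Implicit Types (I P Q : set S).
Let I := mon (nonface_mon D).

Definition facet F := D F /\ forall E, D E -> F \subset E -> E = F.

Lemma var_primeX F j : var_prime K F 'X_j <-> j \notin F.
Proof. by rewrite /var_prime mon_idealX mvars1 finset.sub1set. Qed.

Lemma var_primeS E F : E \subset F -> var_prime K F `<=` var_prime K E.
Proof.
move=> EF; apply: mon_ideal_mono => m; apply: contra => mE.
exact: fintype.subset_trans mE EF.
Qed.

Lemma var_primeS_inv E F : var_prime K F `<=` var_prime K E -> E \subset F.
Proof.
move=> FE; apply/fintype.subsetP => j; apply: contraTT => /var_primeX /FE.
by move/var_primeX.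
Qed.

Lemma var_prime_inj E F : var_prime K F = var_prime K E -> E = F.
Proof.
move=> FE; apply/eqP; rewrite finset.eqEsubset.
by rewrite !var_primeS_inv // FE.
Qed.

Lemma prime_ideal_like Q : prime_ideal Q -> ideal_like Q.
Proof.
case=> -[Q0 _ QD] _; split; first by move: Q0; rewrite inE.
by move=> f g h Qg Qh; have := QD f g h; rewrite !inE; apply.
Qed.

Lemma ideal_sub_var_prime F : D F -> I `<=` var_prime K F.
Proof.
by move=> DF; apply: mon_ideal_mono => m nm; apply/negP => /(dD DF).
Qed.

Lemma prime_prod Q (T : eqType) (s : seq T) (f : T -> S) :
  prime_ideal Q -> Q (\prod_(x <- s) f x) -> exists2 x, x \in s & Q (f x).
Proof.
case=> -[_ Q1 _] Qp; elim: s => [|x s IH].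
  by rewrite big_nil => Q1'; case/negP: Q1; rewrite inE.
rewrite big_cons => Qxs; have := Qp (f x) (\prod_(y <- s) f y).
rewrite !inE => /(_ Qxs) /orP[]; rewrite inE.
  by exists x; rewrite ?mem_head.
by move/IH => [y ys Qy]; exists y; rewrite ?inE ?ys ?orbT.
Qed.

(** A prime that contains I has, for each squarefree generator, a variable of
    this generator; hence the variables outside of it form a face. *)
Lemma prime_over_var_prime Q : prime_ideal Q -> I `<=` Q ->
  exists2 F, D F & var_prime K F `<=` Q.
Proof.
move=> Qp IQ; have Qid := prime_ideal_like Qp.
have [F FE] : exists F : {set 'I_r}, forall j, j \in F <-> ~ Q 'X_j.
  exists [set j | `[< ~ Q 'X_j >]]%SET => j.
  by rewrite inE; split => /asboolP.
exists F; last first.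
  apply: mon_ideal_sub => // m /subsetPn[j]; rewrite inE -lt0n => mj jF.
  have -> : m = (m - U_(j) + U_(j))%MM.
    by rewrite submK //; apply/mnm_lepP => i; rewrite mnm1E; case: eqP => // <-.
  rewrite mpolyXD; apply: ideal_like_mul => //.
  by apply: contrapT => /FE; apply/negP.
apply: contrapT => nDF.
have vF : mvars [multinom (1 * (j \in F))%N | j < r] = F.
  by apply/setP => j; rewrite inE mnmE mul1n; case: (j \in F).
have : Q (var_prod K F).
  rewrite -[var_prod K F]expr1 var_prodXE; apply: IQ; apply/mon_idealX.
  by rewrite /nonface_mon vF.
rewrite /var_prod -big_enum => /(prime_prod Qp)[j]; rewrite mem_enum => /FE.
by [].
Qed.

Lemma facet_over F : D F -> exists2 E, facet E & F \subset E.
Proof.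
have [n] := ubnP (r - #|F|); elim: n F => // n IH F lt DF.
have [fF|/not_andP[//|/existsNP[E /not_implyP[DE /not_implyP[FE EF]]]]] :=
  pselect (facet F); first by exists F.
have FE' : F \proper E.
  rewrite finset.properEneq FE andbT; apply/eqP => eFE; exact: EF (esym eFE).
have FE1 := proper_card FE'.
have Er : (#|E| <= r)%N by rewrite -[X in (_ <= X)%N]card_ord max_card.
have [|E' fE' EE'] := IH E _ DE; first by lia.
by exists E' => //; apply: fintype.subset_trans FE EE'.
Qed.

(** Larger faces have smaller primes, so facets correspond to minimal primes. *)
Lemma minimal_primeP P :
  minimal_prime I P <-> exists2 F, facet F & P = var_prime K F.
Proof.
split.
  case=> Pp IP Pmin; have [F DF FP] := prime_over_var_prime Pp IP.
  have PE E : D E -> var_prime K E `<=` P -> var_prime K E = P.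
    move=> DE; apply: Pmin; first exact: var_prime_prime.
    exact: ideal_sub_var_prime.
  exists F; last by rewrite PE.
  split; first exact: DF.
  move=> E DE FE; apply: var_prime_inj.
  rewrite (PE F DF FP) PE //; apply: subset_trans FP.
  exact: var_primeS.
case=> F [DF Fmax] ->; split; first exact: var_prime_prime.
  exact: ideal_sub_var_prime.
move=> Q Qp IQ QF; have [E DE EQ] := prime_over_var_prime Qp IQ.
have EF : E = F.
  by apply: Fmax => //; apply: var_primeS_inv; apply: subset_trans QF.
by apply/seteqP; split=> //; rewrite -EF.
Qed.

(** The order of the monomial m at the prime of F. *)
Definition codeg m F : nat := (\sum_(j | j \notin F) m j)%N.

Lemma codegD m m' F : codeg (m + m')%MM F = (codeg m F + codeg m' F)%N.
Proof. by rewrite /codeg -big_split; apply: eq_bigr => j _; rewrite mnmDE. Qed.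

Lemma codeg_gt0 m F : (0 < codeg m F)%N = ~~ (mvars m \subset F).
Proof.
apply/idP/idP.
  apply: contraTN => mF; rewrite lt0n negbK; apply/eqP; apply: big1 => j jF.
  apply/eqP; apply: contraNT jF => mj; apply: (fintype.subsetP mF).
  by rewrite inE.
case/subsetPn => j; rewrite inE => mj jF.
by rewrite /codeg (bigD1 j) //= addn_gt0 lt0n mj.
Qed.

Lemma mon_pow_var F n m :
  mon_pow (fun m => ~~ (mvars m \subset F)) n m <-> (n <= codeg m F)%N.
Proof.
elim: n m => [|n IH] m; first by split.
split=> [[m1 [m2 [m1F /IH m2F ->]]]|nm].
  by rewrite -codeg_gt0 in m1F; rewrite codegD; lia.
have : (0 < codeg m F)%N by apply: leq_trans nm.
rewrite codeg_gt0 => /subsetPn[j]; rewrite inE -lt0n => mj jF.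
have mE : m = (U_(j) + (m - U_(j)))%MM.
  rewrite addmC submK //; apply/mnm_lepP => i; rewrite mnm1E.
  by case: eqP => // <-.
exists U_(j)%MM, (m - U_(j))%MM; split=> //.
  by rewrite mvars1 finset.sub1set.
apply/IH; move: nm; rewrite {1}mE codegD.
suff -> : codeg U_(j)%MM F = 1%N by [].
rewrite /codeg (bigD1 j) //= mnm1E eqxx big1 // => i /andP[_ ij].
by rewrite mnm1E eq_sym (negbTE ij).
Qed.

Definition symbolic_mon n m : Prop :=
  forall F, facet F -> (n <= codeg m F)%N.

Lemma upclosed_symbolic n : upclosed (symbolic_mon n).
Proof.
move=> m m' mF le F fF; rewrite -(submK le) codegD.
by apply: leq_trans (mF F fF) (leq_addl _ _).
Qed.

Lemma symbolic_powE n : symbolic_pow I n = mon (symbolic_mon n).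
Proof.
have powE F : ideal_pow (var_prime K F) n = mon (fun m => (n <= codeg m F)%N).
  rewrite ideal_pow_mon; last exact: upclosed_var.
  by apply: eq_mon_ideal => m; apply: mon_pow_var.
apply/seteqP; split=> f.
  move=> H m mf F fF; have := H (var_prime K F); rewrite powE; apply=> //.
  by apply/minimal_primeP; exists F.
move=> H _ /minimal_primeP[F fF ->]; rewrite powE => m /H; exact.
Qed.

(** Removing the elements of a face one by one gives a chain of primes. *)
Lemma prime_chain_face F : D F -> prime_chain I #|F|.
Proof.
move=> DF; pose s := enum F; pose E i : {set 'I_r} := [set j in drop i s]%SET.
have sF j : (j \in s) = (j \in F) by rewrite mem_enum.
have EF i : E i \subset F.
  by apply/fintype.subsetP => j; rewrite inE => /mem_drop; rewrite sF.
exists (fun i => var_prime K (E i)); split=> i iF.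
  split; first exact: var_prime_prime.
  by apply: ideal_sub_var_prime; apply: dD DF (EF i).
have [x _] : exists x, x \in F.
  by apply/set0Pn; rewrite -card_gt0; apply: leq_ltn_trans iF.
have Ei j : j \in E i = (j == nth x s i) || (j \in E i.+1).
  by rewrite !inE (drop_nth x) ?inE // -cardE.
split; first by apply: var_primeS; apply/fintype.subsetP => j; rewrite Ei orbC => ->.
move/var_primeS_inv/fintype.subsetP/(_ (nth x s i)); rewrite Ei eqxx => /(_ isT).
have : uniq (drop i s) by rewrite drop_uniq // enum_uniq.
by rewrite (drop_nth x) -?cardE // inE /= => /andP[/negP].
Qed.

(** A prime over I contains one of the minimal primes whose powers define the
    symbolic power. *)
Lemma prime_over_symbolic n Q : (0 < n)%N -> prime_ideal Q -> I `<=` Q ->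
  symbolic_pow I n `<=` Q.
Proof.
move=> n0 Qp /(prime_over_var_prime Qp)[F DF]; apply: subset_trans.
have [E fE FE] := facet_over DF; apply: subset_trans (var_primeS FE).
rewrite symbolic_powE; apply: mon_ideal_mono => m /(_ E fE).
by rewrite -codeg_gt0; apply: leq_trans.
Qed.

Section Dimension.
Hypothesis hdim : krull_dim I = EFin (Posz 2).

Lemma face_card F : D F -> (#|F| <= 2)%N.
Proof.
move=> DF; have /supremum_le : (krull_dim I <= EFin (Posz 2))%O by rewrite hdim.
by move=> /(_ (EFin #|F|%:Z)); rewrite lee_fin; apply; exists #|F| => //; apply: prime_chain_face.
Qed.

Lemma prime_chain2 : prime_chain I 2.
Proof.
apply: contrapT => n2.
have : (krull_dim I <= EFin (Posz 1))%O.
  apply/supremum_le => _ [d dI <-]; rewrite lee_fin lez_nat.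
  rewrite leqNgt; apply/negP => d1; apply: n2; case: dI => P [P1 P2].
  by exists P; split=> i id; [apply: P1 | apply: P2]; lia.
by rewrite hdim lee_fin.
Qed.

Lemma krull_dim_symbolic n : (0 < n)%N ->
  (EFin (Posz 2) <= krull_dim (symbolic_pow I n))%O.
Proof.
move=> n0; have [+ _] := supremum_isLub [set EFin d%:Z | d in prime_chain (symbolic_pow I n)].
apply; exists 2%N => //; have [P [P1 P2]] := prime_chain2.
exists P; split=> // i i2; have [Pp PI] := P1 i i2; split=> //.
exact: prime_over_symbolic.
Qed.

(** Without vertices every prime over I would contain all variables, and there
    would be no chain of such primes. *)
Lemma exists_vertex : exists j, D [set j]%SET.
Proof.
apply: contrapT => nv; have [P [P1 P2]] := prime_chain2.
have [Pp PI] := P1 0%N isT; have [F DF FP] := prime_over_var_prime Pp PI.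
have F0 : F = finset.set0.
  apply/setP => j; rewrite finset.in_set0; apply/negP => jF; apply: nv; exists j.
  by apply: dD DF _; rewrite finset.sub1set.
have [P01 nP01] := P2 0%N isT.
have [Qp _] := P1 1%N isT; have Qid := prime_ideal_like Qp.
apply: nP01 => f Qf; apply/FP.
have [f0|f0] := eqVneq f@_0%MM 0.
  move=> m mf; rewrite F0 finset.subset0; apply: contraTN mf => /eqP m0.
  suff -> : m = 0%MM by rewrite mcoeff_msupp f0 eqxx.
  apply/mnmP => j; rewrite mnm0E; apply/eqP/negPn/negP => mj.
  by have := finset.in_set0 j; rewrite -m0 inE mj.
case: Qp => -[_ /negP[]]; rewrite inE.
suff Qc : P 1%N (f@_0%MM)%:MP.
  have -> : 1 = (f@_0%MM)^-1%:MP * (f@_0%MM)%:MP :> S.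
    by rewrite -mpolyCM mulVf.
  exact: ideal_like_mul.
have -> : (f@_0%MM)%:MP = -1 * (f - (f@_0%MM)%:MP) + f by ring.
apply: Qid.2 => //; apply: P01; apply: FP => m; rewrite F0 finset.subset0.
apply: contraTN => /eqP m0.
suff -> : m = 0%MM.
  by rewrite mcoeff_msupp mcoeffB mcoeffC eqxx mulr1 subrr eqxx.
apply/mnmP => j; rewrite mnm0E; apply/eqP/negPn/negP => mj.
by have := finset.in_set0 j; rewrite -m0 inE mj.
Qed.

End Dimension.

End StanleyReisner.

(** * Localizations of ordinary and symbolic powers *)

Section Localization.
Variables (r : nat) (D : {set 'I_r} -> Prop) (n : nat).
Local Notation deg := {ffun 'I_r -> int}.
Hypothesis dD : downclosed D.
Hypothesis cardD : forall F, D F -> (#|F| <= 2)%N.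
Implicit Types (m : 'X_{1..r}) (E F : {set 'I_r}) (a : deg) (i j k : 'I_r).

Local Notation pow := (mon_pow (nonface_mon D)).
Local Notation sym := (symbolic_mon D).

Definition zcodeg a E : int := \sum_(j | j \notin E) a j.

Definition msum m E : nat := (\sum_(j in E) m j)%N.

Definition zsum a E : int := \sum_(j in E) a j.

Definition ind_mon F : 'X_{1..r} := [multinom (j \in F : nat) | j < r].

Lemma mvars_ind F : mvars (ind_mon F) = F.
Proof. by apply/setP => j; rewrite inE mnmE; case: (j \in F). Qed.

Lemma mnmB_ind m F j : (m - ind_mon F)%MM j = (m j - (j \in F))%N.
Proof. by rewrite mnmBE mnmE. Qed.

Lemma mnmB_ind_gt q m F j : (q < m j)%N -> (q <= (m - ind_mon F)%MM j)%N.
Proof. by rewrite mnmB_ind; case: (j \in F); lia. Qed.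

Lemma ind_mon_le F m : (forall j, j \in F -> (0 < m j)%N) -> (ind_mon F <= m)%MM.
Proof.
by move=> Fm; apply/mnm_lepP => j; rewrite mnmE; case: (boolP (j \in F)) => // /Fm.
Qed.

(** Products of nonfaces are split off one at a time. *)
Lemma mon_powS q F m : ~ D F -> (ind_mon F <= m)%MM ->
  pow q (m - ind_mon F)%MM -> pow q.+1 m.
Proof.
move=> nF Fm qm; exists (ind_mon F), (m - ind_mon F)%MM; split=> //.
  by rewrite /nonface_mon mvars_ind.
by rewrite addmC submK.
Qed.

Lemma mon_pow_nonface q F m : ~ D F -> (forall j, j \in F -> (q <= m j)%N) ->
  pow q m.
Proof.
move=> nF; elim: q m => [//|q IH] m Fm; apply: (mon_powS nF).
  by apply: ind_mon_le => j /Fm; apply: leq_trans.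
by apply: IH => j jF; rewrite mnmB_ind jF; have := Fm j jF; lia.
Qed.

Lemma codegB m m' E : (m' <= m)%MM -> codeg (m - m')%MM E = (codeg m E - codeg m' E)%N.
Proof. by move=> le; rewrite -{2}(submK le) codegD addnK. Qed.

Lemma exists_codeg m E : (0 < codeg m E)%N -> exists2 j, j \notin E & (0 < m j)%N.
Proof.
rewrite codeg_gt0 => /subsetPn[j]; rewrite inE -lt0n => mj jE; by exists j.
Qed.

Lemma codeg_ind F E : codeg (ind_mon F) E = #|F :\: E|.
Proof.
rewrite /codeg -sum1_card big_mkcond [RHS]big_mkcond; apply: eq_bigr => j _.
by rewrite mnmE !inE; case: (j \in E); case: (j \in F).
Qed.

(** Every variable outside of a facet of maximal size completes it to a
    nonface, so the power of the prime of this facet is generated, after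
    inverting the variables of the facet, by products of such nonfaces. *)
Lemma mon_pow_facet q F m : (forall j, j \notin F -> ~ D (j |: F)) ->
  (forall j, j \in F -> (q <= m j)%N) -> (q <= codeg m F)%N -> pow q m.
Proof.
move=> nF; elim: q m => [//|q IH] m Fm qm.
have [j jF mj] : exists2 j, j \notin F & (0 < m j)%N.
  by apply: exists_codeg; apply: leq_trans qm.
have le : (ind_mon (j |: F) <= m)%MM.
  apply: ind_mon_le => k; rewrite !inE => /orP[/eqP -> //|/Fm].
  exact: leq_trans.
apply: (mon_powS (nF j jF) le); apply: IH.
  move=> k kF; rewrite mnmB_ind !inE kF orbT.
  by have := Fm k kF; lia.
rewrite codegB // codeg_ind.
have -> : (j |: F) :\: F = [set j]%SET.
  apply/setP => k; rewrite !inE; case: eqP => [->|_]; last by case: (k \in F).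
  by rewrite jF.
by rewrite cards1; lia.
Qed.

Lemma pow_symbolic q m : pow q m -> sym q m.
Proof.
move=> qm F [DF _]; elim: q m qm => [//|q IH] _ [m1 [m2 [nm1 /IH m2q ->]]].
rewrite codegD; suff : (0 < codeg m1 F)%N by lia.
by rewrite codeg_gt0; apply/negP => /(dD DF).
Qed.

Lemma zcodeg_shift a F p E :
  zcodeg (shift a F p) E = zcodeg a E + (p * #|F :\: E|)%:Z.
Proof.
rewrite -codeg_ind /codeg big_distrr (big_morph Posz PoszD (erefl _)) -big_split.
by apply: eq_bigr => j _; rewrite ffunE mnmE.
Qed.

Lemma codeg_zmon a E : (forall j, 0 <= a j) -> (codeg (zmon a) E)%:Z = zcodeg a E.
Proof.
move=> a0; rewrite /codeg (big_morph Posz PoszD (erefl _)).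
by apply: eq_bigr => j _; rewrite mnmE gez0_abs.
Qed.

(** Inverting the variables of F makes their exponents as large as needed. *)
Lemma large_shift a F q : neg a \subset F ->
  exists p, (forall j, 0 <= shift a F p j) /\
            (forall j, j \in F -> (q <= zmon (shift a F p) j)%N).
Proof.
move=> aF; exists (q + \sum_j `|a j|)%N.
have aE j : (`|a j| <= \sum_j `|a j|)%N by rewrite (bigD1 j) //= leq_addr.
split=> j; rewrite ?mnmE ffunE; have := aE j; last by move=> + ->; lia.
case: (boolP (j \in F)) => jF; first by lia.
move=> _; rewrite muln0 addr0 leNgt; apply: contra jF => aj.
by apply: (fintype.subsetP aF); rewrite inE.
Qed.

(** Inverting a variable outside of a facet E turns the prime of E into the unit
    ideal, so only the facets that contain F matter. *)
Lemma in_loc_symP a F : neg a \subset F ->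
  in_loc (sym n) F a <-> forall E, facet D E -> F \subset E -> n%:Z <= zcodeg a E.
Proof.
move=> aF; split.
  case=> p [p0 pn] E fE FE; have := pn E fE.
  rewrite -lez_nat codeg_zmon // zcodeg_shift.
  have -> : F :\: E = finset.set0 by apply/eqP; rewrite finset.setD_eq0.
  by rewrite cards0 muln0 addr0.
move=> H; have [p [p0 pn]] := large_shift n aF; exists p; split=> // E fE.
case: (boolP (F \subset E)) => FE.
  rewrite -lez_nat codeg_zmon // zcodeg_shift.
  by have := H E fE FE; lia.
have [x xF xE] := subsetPn FE.
by rewrite /codeg (bigD1 x) //=; have := pn x xF; lia.
Qed.

Lemma in_loc_pow_sym a F : in_loc (pow n) F a -> in_loc (sym n) F a.
Proof. by case=> p [p0 /pow_symbolic]; exists p. Qed.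

Lemma in_loc_nonface a F : neg a \subset F -> ~ D F -> in_loc (pow n) F a.
Proof.
move=> aF nF; have [p [p0 pn]] := large_shift n aF; exists p; split=> //.
exact: mon_pow_nonface nF pn.
Qed.

Lemma facet_card2 F : D F -> #|F| = 2%N -> facet D F.
Proof.
move=> DF F2; split=> // E DE FE; apply/esym/eqP.
by rewrite eqEcard FE F2 cardD.
Qed.

(** With at least two elements, F is either a nonface or a facet, and in both
    cases the localized ideal is the unit ideal or a prime generated by
    variables, for which ordinary and symbolic powers agree. *)
Lemma in_loc_sym_pow a F : neg a \subset F -> (2 <= #|F|)%N ->
  in_loc (sym n) F a -> in_loc (pow n) F a.
Proof.
move=> aF F2; have [DF|nF] := pselect (D F); last first.
  by move=> _; apply: in_loc_nonface.
have cF : #|F| = 2%N by apply/eqP; rewrite eqn_leq F2 cardD.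
move/(in_loc_symP aF) => /(_ F (facet_card2 DF cF) (subxx _)) aFn.
have [p [p0 pn]] := large_shift n aF; exists p; split=> //.
apply: mon_pow_facet pn _.
  by move=> j jF /cardD; rewrite cardsU1 jF cF.
by rewrite -lez_nat codeg_zmon // zcodeg_shift; lia.
Qed.

Definition nbr i : {set 'I_r} := [set j | (j != i) && `[< D (i |: [set j]) >]]%SET.

Lemma nbrP i j : j \in nbr i <-> j != i /\ D (i |: [set j]%SET).
Proof.
rewrite inE; split=> [/andP[ij /asboolP] //|[ij Dij]].
by rewrite ij; apply/asboolP.
Qed.

Lemma nbr_sym i j : j \in nbr i -> i \in nbr j.
Proof. by move/nbrP => [ij Dij]; apply/nbrP; rewrite eq_sym finset.setUC. Qed.

Definition far i : {set 'I_r} := [set k | (k != i) && (k \notin nbr i)]%SET.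

Lemma in_far i k : (k \in far i) = (k != i) && (k \notin nbr i).
Proof. by rewrite [LHS]inE. Qed.

Lemma nbr_irr i : i \notin nbr i.
Proof. by apply/negP => /nbrP[]; rewrite eqxx. Qed.

Lemma sum_vertex i a :
  \sum_k a k = a i + zsum a (far i) + zsum a (nbr i).
Proof.
rewrite (bigD1 i) //= (bigID (mem (nbr i))) /= addrA addrAC.
congr (_ + _ + _); apply: eq_bigl => k; first by rewrite in_far.
by rewrite andbC; case: (boolP (k \in nbr i)) => //= /nbrP[-> _].
Qed.

Lemma sum_ind_mon F (X : {set 'I_r}) : msum (ind_mon F) X = #|F :&: X|.
Proof.
rewrite /msum -sum1_card big_mkcond [RHS]big_mkcond; apply: eq_bigr => j _.
by rewrite mnmE !inE; case: (j \in X); case: (j \in F).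
Qed.

Lemma sum_mon_sub m m' (X : {set 'I_r}) : (m' <= m)%MM ->
  msum m X = (msum (m - m')%MM X + msum m' X)%N.
Proof.
move=> le; rewrite -{1}(submK le) /msum -big_split.
by apply: eq_bigr => k _; rewrite mnmDE.
Qed.

Lemma msumD1 m x (X : {set 'I_r}) : x \in X -> msum m X = (m x + msum m (X :\ x))%N.
Proof. by move=> xX; rewrite /msum (big_setD1 x). Qed.

Lemma sum_gt0_mem m (X : {set 'I_r}) : (0 < msum m X)%N ->
  exists2 k, k \in X & (0 < m k)%N.
Proof.
move=> s0; apply: contrapT => nk; move: s0; rewrite /msum big1 // => k kX.
by apply/eqP; rewrite -leqn0 leqNgt; apply/negP => mk; apply: nk; exists k.
Qed.

(** After inverting the variable of the vertex i, the ideal is generated by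
    the variables outside the star of i and by the products of two distinct
    neighbours of i.  The far variables are used up first.  The conditions on
    what is left say that there are enough factors for the remaining pairs and
    that no neighbour occurs too often to be paired; they are preserved by
    pairing the two most frequent neighbours. *)
Lemma mon_pow_vertex i q m : (q <= m i)%N ->
  let rest := (q - msum m (far i))%N in
  (rest.*2 <= msum m (nbr i))%N ->
  (forall j, j \in nbr i -> (rest + m j <= msum m (nbr i))%N) ->
  pow q m.
Proof.
elim: q m => [//|q IH] m /= qi.
have [s0|] := posnP (msum m (far i)); last first.
  case/sum_gt0_mem => k; rewrite in_far => /andP[ki kN] mk.
  have nF : ~ D (i |: [set k]%SET).
    by move=> DF; case/negP: kN; apply/nbrP.
  have le : (ind_mon (i |: [set k]%SET) <= m)%MM.
    apply: ind_mon_le => j; rewrite finset.in_setU1 finset.in_set1 => /orP[/eqP ->|/eqP -> //].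
    exact: leq_trans qi.
  rewrite !(sum_mon_sub _ le) !sum_ind_mon.
  have -> : #|(i |: [set k]%SET) :&: far i| = 1%N.
    rewrite -(cards1 k); apply: eq_card => j.
    rewrite finset.in_setI finset.in_setU1 !finset.in_set1 in_far.
    case: (eqVneq j k) => [->|_]; first by rewrite ki kN orbT.
    by rewrite orbF; case: (j == i).
  have -> : #|(i |: [set k]%SET) :&: nbr i| = 0%N.
    apply/eqP; rewrite cards_eq0; apply/eqP/setP => j.
    rewrite finset.in_setI !finset.in_setU1 finset.in_set1 finset.in_set0.
    case: (eqVneq j i) => [->|_]; first by rewrite (negbTE (nbr_irr i)).
    by case: (eqVneq j k) => [->|_]; rewrite ?(negbTE kN).
  rewrite addn1 addn0 subSS => W2 Wj.
  apply: (mon_powS nF le); apply: IH => //=.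
    exact: mnmB_ind_gt.
  move=> j jN; apply: leq_trans (Wj j jN); rewrite mnmB_ind.
  by rewrite leq_add2l leq_subr.
rewrite s0 subn0 => W2 Wj.
have [x0 x0N _] : exists2 x, x \in nbr i & (0 < m x)%N.
  by apply: sum_gt0_mem; lia.
(* A third neighbour j for which the bound is tight would have at most the
   exponent of x and of y, and the three would exceed the total. *)
case: (arg_maxnP m x0N) => x xN' xmax.
have xN : x \in nbr i := xN'.
have W1 := msumD1 m xN; have Wx := Wj x xN.
have [y0 y0N my0] : exists2 y, y \in nbr i :\ x & (0 < m y)%N.
  by apply: sum_gt0_mem; move: W1; set u := msum m (_ :\ x); lia.
case: (arg_maxnP m y0N) => y yNx ymax.
have [yx yN] : y != x /\ y \in nbr i by apply/andP; rewrite -finset.in_setD1.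
have my : (0 < m y)%N by apply: leq_trans my0 (ymax _ y0N).
have mx : (0 < m x)%N by apply: leq_trans my (xmax _ yN).
have [xi _] : x != i /\ _ := iffLR (nbrP i x) xN.
have [yi _] : y != i /\ _ := iffLR (nbrP i y) yN.
pose F := (i |: (x |: [set y]))%SET.
have cF : #|F| = 3%N.
  by rewrite !cardsU1 cards1 !inE ![i == _]eq_sym (negbTE xi) (negbTE yi) eq_sym yx.
have nF : ~ D F by move/cardD; rewrite cF.
have le : (ind_mon F <= m)%MM.
  apply: ind_mon_le => j; rewrite !inE => /or3P[]/eqP -> //.
  exact: leq_trans qi.
have cFN : #|F :&: nbr i| = 2%N.
  have -> : F :&: nbr i = (x |: [set y])%SET.
    apply/setP => j; rewrite finset.in_setI !finset.in_setU1 finset.in_set1.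
    case: (eqVneq j i) => [->|_] /=.
      by rewrite (negbTE (nbr_irr i)) eq_sym (negbTE xi) eq_sym (negbTE yi).
    case: (eqVneq j x) => [->|_]; first by rewrite xN.
    by case: (eqVneq j y) => [->|_]; rewrite ?yN.
  by rewrite cards2 eq_sym yx.
have WE := sum_mon_sub (nbr i) le; rewrite sum_ind_mon cFN in WE.
have sE := sum_mon_sub (far i) le; rewrite s0 in sE.
apply: (mon_powS nF le); apply: IH => //=.
- exact: mnmB_ind_gt.
- by move: W2; rewrite WE; clear; lia.
have s0' : msum (m - ind_mon F)%MM (far i) = 0%N.
  by apply/eqP; move/esym/eqP: sE; rewrite addn_eq0 => /andP[].
move=> j jN; rewrite s0' subn0 mnmB_ind; have := Wj j jN.
case: (boolP (j \in F)) => jF.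
  have mj : (0 < m j)%N by move/mnm_lepP/(_ j): le; rewrite mnmE jF.
  by rewrite WE; move: mj; clear; lia.
move: jF; rewrite !inE !negb_or => /and3P[_ jx jy] _.
have jNx : j \in nbr i :\ x by rewrite finset.in_setD1 jx.
have jNxy : j \in nbr i :\ x :\ y by rewrite finset.in_setD1 jy.
have jmax : (m j <= m y)%N := ymax j jNx.
have jmax' : (m y <= m x)%N := xmax y yN.
move: W2 WE; rewrite W1 (msumD1 m yNx) (msumD1 m jNxy).
by move: jmax jmax'; clear; lia.
Qed.

(** In degree a the ordinary and the symbolic power differ at the vertex i: the
    set {i} belongs to the degree complex of the former only. *)
Definition special i a :=
  [/\ neg a \subset [set i]%SET, in_loc (sym n) [set i]%SET a
    & ~ in_loc (pow n) [set i]%SET a].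

Lemma neg1_ge0 i a j : neg a \subset [set i]%SET -> j != i -> 0 <= a j.
Proof.
move/fintype.subsetP/(_ j); rewrite !inE => ai ji.
by rewrite leNgt; apply: contra ji.
Qed.

(** Membership in the symbolic power bounds from below what remains of the
    neighbours when one of them is removed, by the facets through i.  So only
    the total number of factors can prevent membership in the ordinary power. *)
Lemma specialP i a : special i a ->
  [/\ zsum a (far i) < n%:Z,
      zsum a (nbr i) + 2 * zsum a (far i) < 2 * n%:Z
    & forall j, j \in nbr i ->
       n%:Z - zsum a (far i) + a j <= zsum a (nbr i)].
Proof.
case=> ai si npi; set s := zsum a (far i); set W := zsum a (nbr i).
have Di : D [set i]%SET by apply: contrapT => nD; apply: npi; apply: in_loc_nonface.
have Wj j : j \in nbr i -> n%:Z - s + a j <= W.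
  move=> jN; have [ji Dij] := iffLR (nbrP i j) jN.
  have fE : facet D (i |: [set j]%SET).
    by apply: facet_card2 => //; rewrite cards2 eq_sym ji.
  have := iffLR (in_loc_symP ai) si _ fE.
  rewrite finset.sub1set !inE eqxx => /(_ isT).
  suff : zcodeg a (i |: [set j]%SET) + a j = s + W by lia.
  have := sum_vertex i a; rewrite -/s -/W => sumE.
  suff : \sum_k a k = a i + a j + zcodeg a (i |: [set j]%SET) by lia.
  rewrite (bigID (mem (i |: [set j]%SET))) /=; congr (_ + _).
  by rewrite big_setU1 ?big_set1 // inE eq_sym.
have [p [p0 pn]] := large_shift n ai.
pose m := zmon (shift a [set i]%SET p).
have mE j : j != i -> (m j)%:Z = a j.
  by move=> ji; rewrite mnmE gez0_abs // ffunE inE (negbTE ji) muln0 addr0.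
have sE : (msum m (far i))%:Z = s.
  rewrite (big_morph Posz PoszD (erefl _)); apply: eq_bigr => k.
  by rewrite in_far => /andP[ki _]; rewrite mE.
have WE : (msum m (nbr i))%:Z = W.
  rewrite (big_morph Posz PoszD (erefl _)); apply: eq_bigr => k.
  by case/nbrP => ki _; rewrite mE.
have nW : ~ ((n - msum m (far i)).*2 <= msum m (nbr i))%N.
  move=> W2; apply: npi; exists p; split=> //; apply: (@mon_pow_vertex i) => //.
    by apply: pn; rewrite inE.
  move=> j jN; have [ji _] := iffLR (nbrP i j) jN.
  have := Wj j jN; rewrite -(mE j ji) -sE -WE => H.
  have : (m j <= msum m (nbr i))%N by rewrite (msumD1 m jN) leq_addr.
  by move: H; rewrite -/m; clear; lia.
by split=> //; lia.
Qed.

End Localization.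

(** * Cochains on points and edges *)

Section Cohomology.
Variables (K : fieldType) (r : nat).
Implicit Types (E F G : {set 'I_r}) (i j k l x y : 'I_r).
Implicit Types (D : {set 'I_r} -> Prop) (b c : {set 'I_r} -> K).

(** Only the faces of size q + 1 constrain cocycles, and only those of size q
    constrain primitives. *)
Lemma coh_neq0_mono G (D1 D2 : {set 'I_r} -> Prop) q :
  (forall F, G \subset F -> #|F| = q.+1 -> D2 F -> D1 F) ->
  (forall F, G \subset F -> #|F| = q -> D1 F -> D2 F) ->
  coh_neq0 K G D1 q -> coh_neq0 K G D2 q.
Proof.
move=> D21 D12 [c [cc nc]]; exists c; split=> [F GF Fq D2F|[b bP]].
  by apply: cc => //; apply: D21.
by apply: nc; exists b => F GF Fq D1F; apply: bP => //; apply: D12.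
Qed.

Lemma sgn_face_neq0 F j : sgn_face K F j != 0.
Proof. by rewrite expf_neq0 // oppr_eq0 oner_eq0. Qed.

Lemma cech_dlt_point b x :
  cech_dlt finset.set0 b [set x]%SET = sgn_face K [set x]%SET x * b finset.set0.
Proof.
rewrite /cech_dlt big_mkcondr big_set1 finset.sub0set.
by congr (_ * b _); apply/setP => j; rewrite !inE; case: (j == x).
Qed.

Lemma set2D1 x y : x != y -> (x |: [set y])%SET :\ x = [set y]%SET.
Proof.
move=> xy; apply/setP => j; rewrite !inE.
by case: (eqVneq j x) => [->|//]; rewrite (negbTE xy).
Qed.

Lemma cech_dlt_edge G b x y : x != y ->
  cech_dlt G b (x |: [set y])%SET =
    sgn_face K (x |: [set y])%SET x * (if G \subset [set y]%SET then b [set y]%SET else 0) +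
    sgn_face K (x |: [set y])%SET y * (if G \subset [set x]%SET then b [set x]%SET else 0).
Proof.
move=> xy; rewrite /cech_dlt big_mkcondr big_setU1 ?inE //= big_set1.
rewrite set2D1 // [in X in _ + X]finset.setUC set2D1 1?eq_sym //.
by congr (_ + _); case: ifP; rewrite ?mulr0 // finset.setUC.
Qed.

Lemma sgn_face_edge x y : x != y ->
  sgn_face K (x |: [set y])%SET y = - sgn_face K (x |: [set y])%SET x.
Proof.
wlog: x y / (x < y)%N => [H xy|xy _].
  case: (ltngtP x y) => [lt|lt|/val_inj e].
  - exact: H.
  - by rewrite finset.setUC (H y x) ?opprK // eq_sym.
  - by rewrite e eqxx in xy.
rewrite /sgn_face.
have -> : [set h in (x |: [set y])%SET | (h < x)%N]%SET = finset.set0.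
  apply/setP => j; rewrite !inE.
  apply/negbTE/negP => /andP[/orP[]/eqP ->]; first by rewrite ltnn.
  by rewrite ltnNge ltnW.
have -> : [set h in (x |: [set y])%SET | (h < y)%N]%SET = [set x]%SET.
  apply/setP => j; rewrite !inE.
  case: (eqVneq j x) => [->|_] /=; first by rewrite xy.
  by case: eqP => [->|//]; rewrite ltnn.
by rewrite cards0 cards1.
Qed.

(** Up to sign this is the simplicial differential of a graph, so a coboundary is
    zero on an edge exactly when its primitive is equal at both ends. *)
Lemma cech_dlt_edge0 b x y : x != y ->
  cech_dlt finset.set0 b (x |: [set y])%SET =
  sgn_face K (x |: [set y])%SET x * (b [set y]%SET - b [set x]%SET).
Proof.
move=> xy; rewrite cech_dlt_edge // !finset.sub0set sgn_face_edge //.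
by rewrite mulrBr mulNr.
Qed.

End Cohomology.

(** * Nonvanishing of the second cohomology of symbolic powers *)

Section LowerBounds.
Variables (K : fieldType) (r : nat) (D : {set 'I_r} -> Prop) (n : nat).
Local Notation deg := {ffun 'I_r -> int}.
Hypothesis cardD : forall F, D F -> (#|F| <= 2)%N.
Hypothesis n0 : (0 < n)%N.
Implicit Types (E F : {set 'I_r}) (a : deg) (i j k l x y : 'I_r).

Local Notation pow := (mon_pow (nonface_mon D)).
Local Notation sym := (symbolic_mon D).
Local Notation nbr := (nbr D).
Local Notation far := (far D).

Definition sym_face a F := ~ in_loc (sym n) F a.
Definition pow_face a F := ~ in_loc (pow n) F a.

(** The degree complex of the symbolic power has no triangles, so that every
    cochain on edges is a cocycle. *)
Lemma sym_face_card a F : neg a \subset F -> #|F| = 3%N -> sym_face a F -> False.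
Proof.
move=> aF F3; apply; apply/in_loc_symP => // E [DE _] FE.
by have := cardD DE; have := subset_leq_card FE; rewrite F3; lia.
Qed.

Lemma edge_card x y : x \in nbr y -> #|(y |: [set x])%SET| = 2%N.
Proof. by case/nbrP => xy _; rewrite cards2 eq_sym xy. Qed.

Lemma sym_edge a x y : x \in nbr y -> neg a \subset (y |: [set x])%SET ->
  zcodeg a (y |: [set x])%SET < n%:Z -> sym_face a (y |: [set x])%SET.
Proof.
move=> xy aF lt /(in_loc_symP _ _ aF) => /(_ (y |: [set x])%SET).
have [_ Dxy] := iffLR (nbrP _ _ _) xy.
move/(_ (facet_card2 cardD Dxy (edge_card xy)) (subxx _)).
by rewrite leNgt lt.
Qed.

(** The indicator of an edge is a cocycle, as there are no larger faces.  To see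
    that it is not a coboundary one follows a path of other edges on which a
    primitive has zero differential. *)
Lemma coh2_edge a x y :
  x \in nbr y -> neg a \subset (y |: [set x])%SET -> sym_face a (y |: [set x])%SET ->
  (forall b : {set 'I_r} -> K,
    cech_dlt (neg a) b (y |: [set x])%SET = 1 ->
    ~ (forall F, neg a \subset F -> #|F| = 2%N -> sym_face a F ->
         F != (y |: [set x])%SET -> cech_dlt (neg a) b F = 0)) ->
  coh_neq0 K (neg a) (sym_face a) 2.
Proof.
move=> xy ae se nb; exists (fun F => (F == (y |: [set x])%SET)%:R).
split=> [F aF F3 /(sym_face_card aF F3) //|[b bP]].
apply: (nb b); first by rewrite -bP ?eqxx // edge_card.
by move=> F aF F2 sF /negbTE Fe; rewrite -bP // Fe.
Qed.

Lemma set2_neq x y z : x != y -> x != z -> (z |: [set x])%SET != (z |: [set y])%SET.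
Proof.
move=> xy xz; apply/eqP => /setP/(_ x); rewrite !inE eqxx orbT.
by rewrite (negbTE xy) (negbTE xz).
Qed.

Lemma sum_zcodeg a E : (\sum_j a j) = zcodeg a E + zsum a E.
Proof. by rewrite (bigID (mem E)) /= addrC. Qed.

(** With these exponents an edge belongs to the degree complex as soon as it
    misses at most one element of F. *)
Definition cst F : deg := shift 0 F n.-1.

Lemma neg_cst F : neg (cst F) = finset.set0.
Proof. by apply/setP => j; rewrite !inE !ffunE; apply/negbTE; rewrite -leNgt; lia. Qed.

Lemma sum_cst F : \sum_j cst F j = (n.-1 * #|F|)%:Z.
Proof. by rewrite sum_shift big1 ?add0r // => j _; rewrite ffunE. Qed.

Lemma zcodeg_cst F E : zcodeg (cst F) E = (n.-1 * #|F :\: E|)%:Z.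
Proof.
by rewrite zcodeg_shift /zcodeg big1 ?add0r // => j _; rewrite ffunE.
Qed.

Lemma cst_edge F x y : x \in nbr y -> (#|F :\: (y |: [set x])%SET| <= 1)%N ->
  sym_face (cst F) (y |: [set x])%SET.
Proof.
move=> xy F1; apply: sym_edge => //; first by rewrite neg_cst finset.sub0set.
rewrite zcodeg_cst ltz_nat; apply: (@leq_ltn_trans (n.-1 * 1)).
  by rewrite leq_mul2l F1 orbT.
by rewrite muln1; lia.
Qed.

(** Take exponent -1 at i and n - 1 at j and k.  The complex consists of sets
    that contain i, so {i} is the only vertex on which a primitive matters, and
    both edges at i prescribe its value. *)
Lemma coh2_wedge i j k : j \in nbr i -> k \in nbr i -> j != k ->
  exists a, \sum_x a x = 2 * n%:Z - 3 /\ coh_neq0 K (neg a) (sym_face a) 2.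
Proof.
move=> ji ki jk; have [ij Dij] := iffLR (nbrP _ _ _) ji.
have [ik Dik] := iffLR (nbrP _ _ _) ki.
pose b : deg := [ffun x => - (x == i)%:Z]; pose F := (j |: [set k])%SET.
pose a := shift b F n.-1.
have iF : i \notin F by rewrite !inE negb_or ![i == _]eq_sym ij ik.
have na : neg a = [set i]%SET.
  apply/setP => x; rewrite !inE /a ffunE [b x]ffunE.
  case: (eqVneq x i) => [->|_]; first by rewrite (negbTE iF) muln0.
  by apply/negbTE; rewrite -leNgt; lia.
have zb E : i \in E -> zcodeg b E = 0.
  move=> iE; apply: big1 => x xE; rewrite ffunE.
  by case: eqP => [xi|//]; rewrite xi iE in xE.
have edge x : x \in F -> x \in nbr i -> sym_face a (i |: [set x])%SET.
  move=> xF xi; apply: sym_edge => //.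
    by rewrite na finset.sub1set !inE eqxx.
  rewrite zcodeg_shift zb ?inE ?eqxx // add0r ltz_nat.
  have : (#|F :\: (i |: [set x])%SET| < 2)%N.
    have <- : #|F| = 2%N by rewrite cards2 jk.
    apply: proper_card; apply/properP; split; first exact: subsetDl.
    by exists x; rewrite // !inE eqxx orbT.
  by move: n0; case: (n) => // m _; rewrite /= ltnS; case: #|_| => [|[|]] //; lia.
exists a; split.
  rewrite sum_shift cards2 jk (bigD1 i) //= big1 => [|x /negbTE xi].
    by rewrite ffunE eqxx; move: n0; clear; lia.
  by rewrite ffunE xi.
apply: (coh2_edge ji).
- by rewrite na finset.sub1set !inE eqxx.
- by apply: edge => //; rewrite !inE eqxx.
move=> c; rewrite na cech_dlt_edge 1?eq_sym // => c1 /(_ (i |: [set k])%SET).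
rewrite finset.sub1set !inE eqxx edge_card // => /(_ isT erefl).
move/(_ (edge k _ ki)); rewrite !inE eqxx orbT => /(_ isT).
have kj : k != j by rewrite eq_sym.
rewrite set2_neq // => /(_ isT).
rewrite cech_dlt_edge 1?eq_sym //; move/eqP.
rewrite finset.sub1set inE [i == k]eq_sym (negbTE ik) mulr0 add0r subxx.
rewrite mulf_eq0 (negbTE (sgn_face_neq0 _ _ _)) /= => /eqP ci.
move: c1; rewrite finset.sub1set inE [i == j]eq_sym (negbTE ij) mulr0 add0r subxx.
by rewrite ci mulr0 => /esym/eqP; rewrite oner_eq0.
Qed.

Lemma edge_eq (c : {set 'I_r} -> K) x y : x != y ->
  cech_dlt finset.set0 c (y |: [set x])%SET = 0 -> c [set x]%SET = c [set y]%SET.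
Proof.
move=> xy; rewrite cech_dlt_edge0 1?eq_sym // => /eqP.
by rewrite mulf_eq0 (negbTE (sgn_face_neq0 _ _ _)) /= subr_eq0 => /eqP.
Qed.

Lemma edge_neq (c : {set 'I_r} -> K) x y : x != y ->
  cech_dlt finset.set0 c (y |: [set x])%SET = 1 -> c [set x]%SET <> c [set y]%SET.
Proof.
move=> xy + e; rewrite cech_dlt_edge0 1?eq_sym // e subrr mulr0 => /esym/eqP.
by rewrite oner_eq0.
Qed.

Lemma nbr_neq x y : x \in nbr y -> x != y.
Proof. by case/nbrP. Qed.

(** With exponents n - 1 on the triangle, each of its edges omits one vertex and
    lies in the degree complex, which then contains a cycle. *)
Lemma coh2_triangle i j k : j \in nbr i -> k \in nbr i -> k \in nbr j ->
  exists a, \sum_x a x = 3 * n%:Z - 3 /\ coh_neq0 K (neg a) (sym_face a) 2.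
Proof.
move=> ji ki kj; pose F := (i |: (j |: [set k]))%SET.
have [ji' ki' kj'] := And3 (nbr_neq ji) (nbr_neq ki) (nbr_neq kj).
have cF : #|F| = 3%N.
  by rewrite !cardsU1 cards1 !inE ![_ == k]eq_sym (negbTE ki') (negbTE kj') eq_sym (negbTE ji').
have edge x y : x \in nbr y -> x \in F -> y \in F -> sym_face (cst F) (y |: [set x])%SET.
  move=> xy xF yF; apply: cst_edge => //.
  have -> : F :\: (y |: [set x])%SET = F :\ y :\ x.
    by apply/setP => z; rewrite !inE; case: (z == x); case: (z == y).
  have := cardsD1 y F; rewrite yF cF (cardsD1 x (F :\ y)) finset.in_setD1.
  by rewrite (nbr_neq xy) xF !add1n => -[<-].
have [iF jF kF] : [/\ i \in F, j \in F & k \in F] by rewrite !inE !eqxx !orbT.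
exists (cst F); split; first by rewrite sum_cst cF; move: n0; clear; lia.
apply: (coh2_edge ji); rewrite ?neg_cst ?finset.sub0set //; first exact: edge.
move=> c /(edge_neq ji') cij H; apply: cij.
rewrite -(edge_eq kj'); last first.
  apply: H; rewrite ?finset.sub0set ?edge_card //; first exact: edge.
  by rewrite [X in _ != X]finset.setUC set2_neq.
apply: edge_eq => //; apply: H; rewrite ?finset.sub0set ?edge_card //.
  exact: edge.
by rewrite set2_neq.
Qed.

(** Exponents n - 1 on two opposite vertices suffice for the four edges of the
    cycle, since each edge contains one of these vertices. *)
Lemma coh2_square i j k l : j \in nbr i -> j \in nbr l -> k \in nbr i -> k \in nbr l ->
  i != l -> j != k ->
  exists a, \sum_x a x = 2 * n%:Z - 2 /\ coh_neq0 K (neg a) (sym_face a) 2.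
Proof.
move=> ji jl ki kl il jk; pose F := (i |: [set l])%SET.
have [ji' jl' ki' kl'] := And4 (nbr_neq ji) (nbr_neq jl) (nbr_neq ki) (nbr_neq kl).
have edge x y : x \in nbr y -> y \in F -> sym_face (cst F) (y |: [set x])%SET.
  move=> xy yF; apply: cst_edge => //.
  have := cardsD1 y F; rewrite yF cards2 il add1n => -[->].
  by apply: subset_leq_card; apply: finset.setDS; rewrite finset.sub1set !inE eqxx.
have [iF lF] : i \in F /\ l \in F by rewrite !inE !eqxx !orbT.
exists (cst F); split; first by rewrite sum_cst cards2 il; move: n0; clear; lia.
apply: (coh2_edge ji); rewrite ?neg_cst ?finset.sub0set //; first exact: edge.
move=> c /(edge_neq ji') cij H; apply: cij.
rewrite (@edge_eq c j l) //; last first.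
  apply: H; rewrite ?finset.sub0set ?edge_card //; first exact: edge.
  by rewrite ![(_ |: [set j])%SET]finset.setUC; apply: set2_neq; rewrite eq_sym.
rewrite -(@edge_eq c k l) //; last first.
  apply: H; rewrite ?finset.sub0set ?edge_card //; first exact: edge.
  apply/eqP => /setP/(_ k); rewrite !inE eqxx orbT.
  by rewrite (negbTE ki') eq_sym (negbTE jk).
apply: edge_eq => //; apply: H; rewrite ?finset.sub0set ?edge_card //.
  exact: edge.
by rewrite set2_neq // eq_sym.
Qed.

End LowerBounds.
(** * Degrees of the first cohomology of ordinary powers *)

Section Bounds.
Variables (K : fieldType) (r : nat) (D : {set 'I_r} -> Prop) (n : nat).
Local Notation deg := {ffun 'I_r -> int}.
Hypothesis dD : downclosed D.
Hypothesis cardD : forall F, D F -> (#|F| <= 2)%N.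
Hypothesis n0 : (0 < n)%N.
Implicit Types (E F X Y : {set 'I_r}) (a : deg) (i j k l x y : 'I_r) (t : int).

Local Notation nbr := (nbr D).
Local Notation far := (far D).
Local Notation special := (special D n).

Lemma zsumD1 a x X : x \in X -> zsum a X = a x + zsum a (X :\ x).
Proof. by move=> xX; rewrite /zsum (big_setD1 x). Qed.

Lemma zsum1 a x : zsum a [set x]%SET = a x.
Proof. by rewrite /zsum big_set1. Qed.

Lemma zsum2 a x y : x != y -> zsum a (x |: [set y])%SET = a x + a y.
Proof. by move=> xy; rewrite /zsum big_setU1 ?inE // big_set1. Qed.

Lemma zsum_ge0 a X : (forall k, k \in X -> 0 <= a k) -> 0 <= zsum a X.
Proof. by move=> a0; apply: sumr_ge0. Qed.

Lemma zsum_gt0 a X : 0 < zsum a X -> exists2 k, k \in X & 0 < a k.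
Proof.
move=> X0; apply: contrapT => nk; move: X0; rewrite ltNge => /negP; apply.
apply: sumr_le0 => k kX; rewrite leNgt; apply/negP => ak; apply: nk.
by exists k.
Qed.

Lemma zsum_le a X Y : X \subset Y -> (forall k, k \in Y -> 0 <= a k) ->
  zsum a X <= zsum a Y.
Proof.
move=> XY a0; rewrite {2}/zsum (big_setID X) /= (finset.setIidPr XY) lerDl.
by apply: sumr_ge0 => k; rewrite finset.in_setD => /andP[_ /a0].
Qed.

Lemma special_nbr_ge0 i a k : special i a -> k \in nbr i -> 0 <= a k.
Proof. by case=> ai _ _ /nbr_neq; apply: neg1_ge0. Qed.

Lemma special_far_ge0 i a k : special i a -> k \in far i -> 0 <= a k.
Proof. by case=> ai _ _; rewrite in_far => /andP[ki _]; apply: neg1_ge0 ki. Qed.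

(** If the neighbours of i had no weight there would be none of them; then {i} is
    a facet, and the far variables alone would reach the power n. *)
Lemma special_nbr_gt0 i a : special i a -> 0 < zsum a (nbr i).
Proof.
move=> sp; have [sn _ Wj] := specialP cardD sp.
have [[j jN]|nN] := pselect (exists j, j \in nbr i).
  by have := Wj j jN; have := special_nbr_ge0 sp jN; move: sn; clear; lia.
case: sp => ai si npi.
have Di : D [set i]%SET by apply: contrapT => nD; apply: npi; apply: in_loc_nonface.
have fi : facet D [set i]%SET.
  split=> // E DE iE; apply/eqP; rewrite eq_sym finset.eqEsubset iE /=.
  apply/fintype.subsetP => x xE; rewrite inE; apply/negPn/negP => xi.
  apply: nN; exists x; apply/nbrP; split=> //; apply: dD DE _.
  by rewrite finset.subUset iE finset.sub1set.
have := iffLR (in_loc_symP _ _ ai) si _ fi (subxx _).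
have := sum_vertex D i a; rewrite (sum_zcodeg a [set i]%SET) zsum1.
by move: sn; clear; lia.
Qed.

(** By the bounds of the symbolic power the neighbours of i have positive total
    weight even after one of them is removed. *)
Lemma special_wedge i a : special i a ->
  exists j k, [/\ j \in nbr i, k \in nbr i, j != k, 0 < a j & 0 < a k].
Proof.
move=> sp; have [k kN ak] := zsum_gt0 (special_nbr_gt0 sp).
have [sn _ Wj] := specialP cardD sp.
have [j] : exists2 j, j \in nbr i :\ k & 0 < a j.
  apply: zsum_gt0; have := Wj k kN; rewrite (zsumD1 _ kN).
  by move: sn; set u := zsum a (_ :\ k); lia.
rewrite finset.in_setD1 => /andP[jk jN] aj.
by exists j, k.
Qed.

Lemma special_nbr_le i a j : special i a -> j \in nbr i ->
  a j + zsum a (far i) < n%:Z.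
Proof.
move=> sp jN; have [_ W2 Wj] := specialP cardD sp.
by have := Wj j jN; move: W2; clear; lia.
Qed.

(** In cohomological degree 1 the degree t contributes t + 1 to the regularity,
    which should be at most the contribution s + 2 of a degree s in which the
    second cohomology of the symbolic power is nonzero. *)
Definition dominated t : Prop :=
  exists a, coh_neq0 K (neg a) (sym_face D n a) 2 /\ t <= \sum_x a x + 1.

Lemma dominated_wedge i a t : special i a -> t <= 2 * n%:Z - 2 -> dominated t.
Proof.
move=> /special_wedge[j [k [jN kN jk _ _]]] tn.
have [b [bn cb]] := coh2_wedge K cardD n0 jN kN jk; exists b; split=> //.
by rewrite bn; move: tn; clear; lia.
Qed.

Lemma dominated_triangle i j k t :
  j \in nbr i -> k \in nbr i -> k \in nbr j -> t <= 3 * n%:Z - 2 -> dominated t.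
Proof.
move=> ji ki kj tn; have [b [bn cb]] := coh2_triangle K cardD n0 ji ki kj.
by exists b; split=> //; rewrite bn; move: tn; clear; lia.
Qed.

Lemma dominated_square i j k l t :
  j \in nbr i -> j \in nbr l -> k \in nbr i -> k \in nbr l -> i != l -> j != k ->
  t <= 2 * n%:Z - 1 -> dominated t.
Proof.
move=> ji jl ki kl il jk tn.
have [b [bn cb]] := coh2_square K cardD n0 ji jl ki kl il jk.
by exists b; split=> //; rewrite bn; move: tn; clear; lia.
Qed.

Lemma dominated_neg i a : special i a -> a i < 0 -> dominated (\sum_x a x).
Proof.
move=> sp ai; apply: (dominated_wedge sp); rewrite (sum_vertex D i).
have [_ W2 _] := specialP cardD sp.
have := zsum_ge0 (fun k => @special_far_ge0 i a k sp).
by move: W2 ai; clear; lia.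
Qed.

(** Outside of E the total degree is at most n - 1.  Each neighbour of i has
    exponent at most n - 1 minus the weight of the far vertices, so E adds at
    most n - 1 unless it consists of two neighbours, which then form a triangle
    with i. *)
Lemma dominated_facet i a E : special i a -> facet D E -> i \notin E ->
  (forall x, 0 <= a x) -> zcodeg a E < n%:Z -> dominated (\sum_x a x).
Proof.
move=> sp [DE _] iE a0 En; have [sn W2 Wj] := specialP cardD sp.
have [[j [k [jE kE jk jN kN]]]|nT] := pselect (exists j k,
    [/\ j \in E, k \in E, j != k, j \in nbr i & k \in nbr i]).
  have EE : E = (j |: [set k])%SET.
    apply/esym/eqP; rewrite eqEcard finset.subUset !finset.sub1set jE kE.
    by rewrite cards2 jk cardD.
  have kj : k \in nbr j by apply/nbrP; rewrite eq_sym -EE.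
  apply: (dominated_triangle jN kN kj).
  rewrite (sum_zcodeg a E) {2}EE zsum2 //.
  have := special_nbr_le sp jN; have := special_nbr_le sp kN.
  have := zsum_ge0 (fun k => @special_far_ge0 i a k sp).
  by move: En sn; clear; lia.
apply: (dominated_wedge sp); rewrite (sum_zcodeg a E).
have EN : zsum a (E :&: nbr i) + zsum a (far i) < n%:Z.
  have [E0|[j]] := set_0Vmem (E :&: nbr i).
    by rewrite E0 /zsum big_set0 add0r.
  rewrite finset.in_setI => /andP[jE jN].
  have -> : E :&: nbr i = [set j]%SET.
    apply/setP => k; rewrite finset.in_setI finset.in_set1.
    apply/andP/eqP => [[kE kN]|-> //]; apply/eqP/negPn/negP => kj.
    by apply: nT; exists j, k; split=> //; rewrite eq_sym.
  by rewrite zsum1; apply: special_nbr_le.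
have EF : zsum a (E :\: nbr i) <= zsum a (far i).
  apply: zsum_le => // ; apply/fintype.subsetP => k.
  rewrite finset.in_setD in_far => /andP[-> kE]; rewrite andbT.
  by apply: contraNneq iE => <-.
have : zsum a E = zsum a (E :&: nbr i) + zsum a (E :\: nbr i).
  by rewrite {1}/zsum (big_setID (nbr i)).
by move: EN EF En; clear; lia.
Qed.

(** If neither of two special vertices is a neighbour of the other, each is among
    the far vertices of the other, and adding the two bounds gives 2n - 1.
    Equality leaves no weight on further far vertices, so the neighbours of i
    with positive exponent are neighbours of l as well and give a 4-cycle. *)
Lemma dominated_far i l a : special i a -> special l a -> i != l ->
  l \notin nbr i -> (forall x, 0 <= a x) -> dominated (\sum_x a x).
Proof.
move=> spi spl il lNi a0.
have iNl : i \notin nbr l by apply: contra lNi; apply: nbr_sym.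
have lF : l \in far i by rewrite in_far eq_sym il.
have iF : i \in far l by rewrite in_far il.
have [_ Wi _] := specialP cardD spi; have [_ Wl _] := specialP cardD spl.
have si := zsumD1 a lF; have sl := zsumD1 a iF.
have si0 : 0 <= zsum a (far i :\ l) by apply: zsum_ge0.
have sl0 : 0 <= zsum a (far l :\ i) by apply: zsum_ge0.
have Ei := sum_vertex D i a; have El := sum_vertex D l a.
have [le|gt] := leP (\sum_x a x) (2 * n%:Z - 2).
  exact: (dominated_wedge spi).
have ilE : zsum a (far l :\ i) = 0.
  by move: Wi Wl si sl si0 sl0 Ei El gt; clear; lia.
have common x : x \in nbr i -> 0 < a x -> x \in nbr l.
  move=> xN ax; apply/negPn/negP => xl.
  have xF : x \in far l :\ i.
    rewrite finset.in_setD1 (nbr_neq xN) in_far xl andbT.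
    by apply: contraNneq lNi => <-.
  move: ilE; rewrite (zsumD1 _ xF).
  have : 0 <= zsum a (far l :\ i :\ x) by apply: zsum_ge0.
  by move: ax; clear; lia.
have [j [k [jN kN jk aj ak]]] := special_wedge spi.
apply: (dominated_square jN (common _ jN aj) kN (common _ kN ak) il jk).
by move: Wi Wl si sl si0 sl0 Ei El gt; clear; lia.
Qed.

(** If the adjacent special vertices i and l have no common neighbour, then the
    neighbours of i other than l are far from l.  This forces the far weights
    of i and l to add up to at least n, which lowers the bound 3n - 2 to
    2n - 2. *)
Lemma dominated_near i l a : special i a -> special l a ->
  l \in nbr i -> (forall x, 0 <= a x) -> dominated (\sum_x a x).
Proof.
move=> spi spl lN a0; have iN := nbr_sym lN.
have [si Wi Wij] := specialP cardD spi.
have Ei := sum_vertex D i a.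
have li := Wij l lN; have ai := special_nbr_le spl iN.
have si0 : 0 <= zsum a (far i) by apply: zsum_ge0.
have sl0 : 0 <= zsum a (far l) by apply: zsum_ge0.
have [[x [xi xl]]|nx] := pselect (exists x, x \in nbr i /\ x \in nbr l).
  apply: (dominated_triangle lN xi xl).
  by move: Ei Wi ai si0 sl0; clear; lia.
apply: (dominated_wedge spi).
have sub : zsum a (nbr i :\ l) <= zsum a (far l).
  apply: zsum_le => //; apply/fintype.subsetP => x.
  rewrite finset.in_setD1 in_far => /andP[-> xi] /=.
  by apply/negP => xl; apply: nx; exists x.
have Wl := zsumD1 a lN.
by move: Ei Wi ai li si0 sl0 sub Wl; clear; lia.
Qed.

(** Without a special vertex the complexes agree on nonempty sets.  Such a vertex i
    is isolated in the complex of the ordinary power, so if the exponent at i is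
    nonnegative, nonzero cohomology needs a second vertex l of that complex. *)
Lemma coh1_pow a : coh_neq0 K (neg a) (pow_face D n a) 1 ->
  coh_neq0 K (neg a) (sym_face D n a) 1 \/ dominated (\sum_x a x).
Proof.
move=> ca; have [[i [ai si pi]]|ns] := pselect (exists i,
    [/\ neg a \subset [set i]%SET, in_loc (symbolic_mon D n) [set i]%SET a
      & pow_face D n a [set i]%SET]); last first.
  left; apply: coh_neq0_mono ca => F aF F1.
    by move=> sF /(in_loc_pow_sym dD).
  have /cards1P[x xF] : #|F| == 1%N by rewrite F1.
  by rewrite xF in aF *; move=> pF sF; apply: ns; exists x.
right; have sp : special i a by split.
have [ai0|ai0] := ltP (a i) 0; first exact: dominated_neg sp ai0.
have na : neg a = finset.set0.
  apply/eqP; rewrite -finset.subset0; apply/fintype.subsetP => x xa.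
  move/fintype.subsetP/(_ x xa): (ai); rewrite inE => /eqP xi.
  by move: xa; rewrite xi inE ltNge ai0.
have a0 x : 0 <= a x.
  by rewrite leNgt; apply/negP => ax; have := finset.in_set0 x; rewrite -na inE ax.
have [[l [li pl]]|nl] := pselect (exists l, l != i /\ pow_face D n a [set l]%SET).
  have al : neg a \subset [set l]%SET by rewrite na finset.sub0set.
  have [sl|nsl] := pselect (in_loc (symbolic_mon D n) [set l]%SET a).
    have spl : special l a by split.
    case: (boolP (l \in nbr i)) => lN; first exact: dominated_near sp spl lN a0.
    by apply: dominated_far sp spl _ lN a0; rewrite eq_sym.
  have [E [fE lE En]] : exists E,
      [/\ facet D E, [set l]%SET \subset E & zcodeg a E < n%:Z].
    apply: contrapT => nE; apply: nsl; apply/(in_loc_symP _ _ al) => E fE lE.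
    by rewrite leNgt; apply/negP => En; apply: nE; exists E.
  apply: (dominated_facet sp fE) => //; apply/negP => iE.
  have := iffLR (in_loc_symP _ _ ai) si E fE; rewrite finset.sub1set iE.
  by move/(_ isT); rewrite leNgt En.
exfalso; case: ca => c [_ nc]; apply: nc.
exists (fun=> c [set i]%SET / sgn_face K [set i]%SET i) => F aF F1 pF.
have /cards1P[x xF] : #|F| == 1%N by rewrite F1.
have xi : x = i.
  by apply/eqP/negPn/negP => xi; apply: nl; exists x; rewrite -xF.
rewrite xF xi na cech_dlt_point mulrC divfK //; exact: sgn_face_neq0.
Qed.

End Bounds.

(** * Geometric regularity and regularity *)

Section Regularity.
Variables (K : fieldType) (r : nat).
Implicit Types (J : set {mpoly K[r]}) (M : extended int).

(** Bounding the regularity from above amounts to bounding every single degree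
    of nonzero cohomology, which removes the nested suprema. *)
Lemma ubound_a_inv J (R : set nat) M :
  ubound [set adde (a_inv J i) (EFin i%:Z) | i in R] M <->
  forall i t, R i -> local_coh_neq0 J i t -> (EFin (t + i%:Z) <= M)%O.
Proof.
split=> [ub i t Ri Jt|H _ [i Ri <-]].
  by apply: iffLR (adde_supremum_le (local_coh_neq0 J i) i%:Z M) _ t Jt; apply: ub; exists i.
by apply/adde_supremum_le => t; apply: H.
Qed.

Variables (D : {set 'I_r} -> Prop) (n : nat).
Hypothesis dD : downclosed D.
Hypothesis cardD : forall F, D F -> (#|F| <= 2)%N.

Lemma pow_coh_ge3 i a : (2 < i)%N -> ~ coh_neq0 K (neg a) (pow_face D n a) i.
Proof.
move=> i2 [c [_ nc]]; apply: nc; exists (fun=> 0) => F aF Fi; case.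
by apply: in_loc_nonface => // /cardD; rewrite Fi leqNgt i2.
Qed.

(** The symbolic power has no embedded components, in particular the maximal
    ideal is not associated to it. *)
Lemma sym_coh0 a : (exists j, D [set j]%SET) ->
  ~ coh_neq0 K (neg a) (sym_face D n a) 0.
Proof.
case=> v Dv [c [cc nc]]; apply: nc; exists (fun=> 0) => F aF F0 sF.
have {F0}F0 : F = finset.set0 by apply: cards0_eq.
have na : neg a = finset.set0 by apply/eqP; rewrite -finset.subset0 -F0.
have ax x : neg a \subset [set x]%SET by rewrite na finset.sub0set.
have [E [[DE Emax] En]] : exists E, facet D E /\ ~ (n%:Z <= zcodeg a E).
  apply: contrapT => nE; apply: sF; apply/(in_loc_symP _ _ aF) => E fE _.
  by apply: contrapT => En; apply: nE; exists E.
have [x xE] : exists x, x \in E.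
  apply/set0Pn/eqP => E0; have := Emax _ Dv; rewrite E0 finset.sub0set.
  by move=> /(_ isT) /setP/(_ v); rewrite !inE eqxx.
have sx : sym_face D n a [set x]%SET.
  move/(in_loc_symP _ _ (ax x)) => /(_ E); rewrite finset.sub1set xE.
  by move=> H; apply: En; apply: H.
have := cc _ (ax x) (cards1 x) sx; rewrite na cech_dlt_point => /eqP.
rewrite mulf_eq0 (negbTE (sgn_face_neq0 _ _ _)) /= F0 => /eqP ->.
by rewrite /cech_dlt big1 // => j; rewrite finset.in_set0.
Qed.

Lemma sym_pow_coh a i : (0 < i)%N ->
  coh_neq0 K (neg a) (sym_face D n a) i -> coh_neq0 K (neg a) (pow_face D n a) i.
Proof.
move=> i0; apply: coh_neq0_mono => F aF Fi.
  by move=> pF sF; apply: pF; apply: in_loc_sym_pow => //; rewrite Fi.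
by move=> sF /(in_loc_pow_sym dD).
Qed.

Lemma pow_sym_coh2 a :
  coh_neq0 K (neg a) (pow_face D n a) 2 -> coh_neq0 K (neg a) (sym_face D n a) 2.
Proof.
apply: coh_neq0_mono => F aF Fi.
  by move=> sF /(in_loc_pow_sym dD).
by move=> pF sF; apply: pF; apply: in_loc_sym_pow => //; rewrite Fi.
Qed.

End Regularity.

Theorem corollary4p3 (K : fieldType) (r : nat) (I : set {mpoly K[r]})
    (hI : squarefree_monomial_ideal I)
    (hdim : krull_dim I = EFin (Posz 2))
    (n : nat) (hn : (1 <= n)%N) :
  g_reg (ideal_pow I n) = reg (symbolic_pow I n).
Proof.
have [D dD ID] := squarefree_nonface hI; rewrite ID in hdim *.
have cardD := face_card dD hdim; have vD := exists_vertex dD hdim.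
have dimn := krull_dim_symbolic dD hdim hn.
pose J1 := ideal_pow (@mon_ideal K r (nonface_mon D)) n.
pose J2 := symbolic_pow (@mon_ideal K r (nonface_mon D)) n.
have powP i t : local_coh_neq0 J1 i t <->
    exists a : {ffun 'I_r -> int}, \sum_j a j = t /\ coh_neq0 K (neg a) (pow_face D n a) i.
  rewrite /J1 ideal_pow_mon; last exact: upclosed_nonface.
  by apply: local_coh_neq0P; apply/upclosed_pow/upclosed_nonface.
have symP i t : local_coh_neq0 J2 i t <->
    exists a : {ffun 'I_r -> int}, \sum_j a j = t /\ coh_neq0 K (neg a) (sym_face D n a) i.
  rewrite /J2 symbolic_powE //.
  by apply: local_coh_neq0P; apply: upclosed_symbolic.
apply: supremum_eq => M; apply: iff_trans; first exact: ubound_a_inv.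
apply: iff_trans; last by apply: iff_sym; exact: ubound_a_inv.
split=> H i t /=.
  move=> _ /symP[a [at_ ca]]; have [i0|i0] := posnP i.
    by rewrite i0 in ca; case: (sym_coh0 vD ca).
  by apply: H => //; apply/powP; exists a; split=> //; apply: sym_pow_coh.
have le2 q : (q <= 2)%N -> (EFin q%:Z <= krull_dim J2)%O.
  by move=> q2; apply: le_trans dimn; rewrite lee_fin lez_nat.
move=> i0 /powP[a [at_ ca]]; have [i2|i2] := leqP i 2; last first.
  by case: (pow_coh_ge3 cardD i2 ca).
have [i1|i1] := eqVneq i 1%N.
  rewrite i1 in ca *; case: (coh1_pow dD cardD hn ca) => [sa|[b [cb tb]]].
    by apply: H; [exact: le2 | apply/symP; exists a].
  have := H 2%N (\sum_j b j) (le2 2%N isT).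
  move=> /(_ (iffRL (symP _ _) _)) bM; apply: le_trans (bM _); last by exists b.
  by rewrite lee_fin -at_; move: tb; clear; lia.
have i_eq : i = 2%N by move: i0 i1 i2; clear; lia.
rewrite i_eq in ca *; apply: H; first exact: le2.
by apply/symP; exists a; split=> //; apply: pow_sym_coh2.
Qed.
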